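(* Let $0<2\nu<1$ and $\varepsilon\in(0,1)$. The eigenvalues of the operator $\mathcal L_a+\varepsilon^{1-\nu}\mathcal L_g$ lie within the neighborhood of radius $\varepsilon^{1-\nu}$ of the eigenvalues of the operator $\mathcal L_a$. More precisely, if $i\omega$ is an eigenvalue of $\mathcal L_a+\varepsilon^{1-\nu}\mathcal L_g$, then there exists $m\in\{0,1,2,\dots\}$ such that $$|\omega_{\mathrm{ac},m}^\pm|^2\le|\omega|^2\le|\omega_{\mathrm{ac},m}^\pm|^2+\varepsilon^{2-2\nu},$$ where $\{i\omega_{\mathrm{ac},m}^\pm\}_{m\in\{0,1,2,\dots\}}$ are the eigenvalues of $\mathcal L_a$. Therefore, the eigenvalues of $\frac1\varepsilon\mathcal L_a+\frac1{\varepsilon^\nu}\mathcal L_g$ can be classified into three families: mean flow frequencies with $|\iota_{\mathrm{mf}}|=0$; internal wave frequencies with $|\iota_{\mathrm{gw}}|=\mathcal O(\varepsilon^{-\nu})$; and perturbed acoustic wave frequencies with $|\iota_{\mathrm{aw}}|=\mathcal O(\varepsilon^{-1})$.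
   Context: $\mathbb T^3=(\mathbb R/\mathbb Z)^3$ with coordinates $(x,y,z)$; $\nabla_h=(\partial_x,\partial_y)^\top$, $\mathrm{div}_h=\nabla_h\cdot$. For $U=(\widetilde q,\widetilde{\mathcal H},v,w)^\top$ with $v=(v_1,v_2)^\top$, $$\mathcal L_aU=(\mathrm{div}_hv+\partial_zw,\ 0,\ \nabla_h\widetilde q,\ \partial_z\widetilde q)^\top,\qquad \mathcal L_gU=(0,\ -w,\ 0,\ \widetilde{\mathcal H})^\top.$$ The operators act on (complex-valued) smooth fields $U$ on $\mathbb T^3$ such that $\widetilde q,\widetilde{\mathcal H},v,w$ are respectively even, odd, even, odd in $z$; both are anti-symmetric in $L^2$, so eigenvalues are purely imaginary. The eigenvalues of $\mathcal L_a$ are denoted $i\omega^\pm_{\mathrm{ac},m}$, ordered so that $\omega^\pm_{\mathrm{ac},0}=0$, $|\omega^\pm_{\mathrm{ac},1}|<|\omega^\pm_{\mathrm{ac},2}|<\cdots$, with $\omega^+_{\mathrm{ac},m}=-\omega^-_{\mathrm{ac},m}$; the values $(\omega^\pm_{\mathrm{ac},m})^2$ are the eigenvalues of $-\Delta$ on $\mathbb T^3$ on scalar functions even in $z$. The operator $\frac1\varepsilon\mathcal L_a+\frac1{\varepsilon^\nu}\mathcal L_g=\frac1\varepsilon(\mathcal L_a+\varepsilon^{1-\nu}\mathcal L_g)$. The orders $\mathcal O(\varepsilon^{-\nu})$, $\mathcal O(\varepsilon^{-1})$ refer to the limit $\varepsilon\to0^+$ for a fixed Fourier wave number. *)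

(* Defs.v *)
From Stdlib Require Import Reals ZArith List.
From Coquelicot Require Import Coquelicot.
Open Scope R_scope.

(* Functions on the torus (R/Z)^3 are functions on R^3 that are 1-periodic
   in each coordinate. *)
Definition scalar := R -> R -> R -> C.

Definition periodic (f : scalar) : Prop :=
  forall x y z, f (x + 1) y z = f x y z /\ f x (y + 1) z = f x y z /\
                f x y (z + 1) = f x y z.

Definition even_z (f : scalar) : Prop := forall x y z, f x y (- z) = f x y z.
Definition odd_z (f : scalar) : Prop :=
  forall x y z, f x y (- z) = Copp (f x y z).

Inductive axis : Set := axis_x | axis_y | axis_z.

Definition coordinate (i : axis) (x y z : R) : R :=
  match i with axis_x => x | axis_y => y | axis_z => z end.

Definition line (i : axis) (f : scalar) (x y z : R) : R -> C :=
  match i with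
  | axis_x => fun s => f s y z
  | axis_y => fun s => f x s z
  | axis_z => fun s => f x y s
  end.

(* Total derivative operator on complex-valued functions of a real variable;
   only meaningful where the function is differentiable. *)
Definition CDerive (g : R -> C) (t : R) : C :=
  (Derive (fun s => Re (g s)) t, Derive (fun s => Im (g s)) t).

Definition partial (i : axis) (f : scalar) : scalar :=
  fun x y z => CDerive (line i f x y z) (coordinate i x y z).

Definition iter_partial (l : list axis) (f : scalar) : scalar :=
  fold_right partial f l.

Definition smooth (f : scalar) : Prop :=
  forall (l : list axis) (x y z : R),
    @continuous (prod_UniformSpace (prod_UniformSpace R_UniformSpace R_UniformSpace)
                                   R_UniformSpace)
                C_UniformSpace
      (fun p => iter_partial l f (fst (fst p)) (snd (fst p)) (snd p)) ((x, y), z) /\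
    forall i : axis,
      @ex_derive R_AbsRing C_R_NormedModule
        (line i (iter_partial l f) x y z) (coordinate i x y z).

Record field : Type := Field
  { fq : scalar; fH : scalar; fv1 : scalar; fv2 : scalar; fw : scalar }.

Definition feq (U V : field) : Prop :=
  forall x y z,
    fq U x y z = fq V x y z /\ fH U x y z = fH V x y z /\
    fv1 U x y z = fv1 V x y z /\ fv2 U x y z = fv2 V x y z /\
    fw U x y z = fw V x y z.

Definition szero : scalar := fun _ _ _ => RtoC 0.
Definition sadd (f g : scalar) : scalar := fun x y z => Cplus (f x y z) (g x y z).
Definition sscal (c : C) (f : scalar) : scalar := fun x y z => Cmult c (f x y z).

Definition fzero : field := Field szero szero szero szero szero.
Definition fadd (U V : field) : field :=
  Field (sadd (fq U) (fq V)) (sadd (fH U) (fH V)) (sadd (fv1 U) (fv1 V))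
        (sadd (fv2 U) (fv2 V)) (sadd (fw U) (fw V)).
Definition fscal (c : C) (U : field) : field :=
  Field (sscal c (fq U)) (sscal c (fH U)) (sscal c (fv1 U))
        (sscal c (fv2 U)) (sscal c (fw U)).

Definition on_components (P : scalar -> Prop) (U : field) : Prop :=
  P (fq U) /\ P (fH U) /\ P (fv1 U) /\ P (fv2 U) /\ P (fw U).

Definition admissible (U : field) : Prop :=
  on_components periodic U /\ on_components smooth U /\
  even_z (fq U) /\ odd_z (fH U) /\ even_z (fv1 U) /\ even_z (fv2 U) /\ odd_z (fw U).

Definition La (U : field) : field :=
  Field
    (sadd (sadd (partial axis_x (fv1 U)) (partial axis_y (fv2 U)))
          (partial axis_z (fw U)))
    szero
    (partial axis_x (fq U))
    (partial axis_y (fq U))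
    (partial axis_z (fq U)).

Definition Lg (U : field) : field :=
  Field szero (sscal (RtoC (-1)) (fw U)) szero szero (fH U).

Definition lin_comb (a b : R) (U : field) : field :=
  fadd (fscal (RtoC a) (La U)) (fscal (RtoC b) (Lg U)).

(* L_a + eps^(1-nu) L_g *)
Definition L_pert (nu eps : R) : field -> field :=
  lin_comb 1 (Rpower eps (1 - nu)).

(* (1/eps) L_a + (1/eps^nu) L_g *)
Definition L_full (nu eps : R) : field -> field :=
  lin_comb (/ eps) (/ Rpower eps nu).

Definition eigenvalue_in (D : field -> Prop) (A : field -> field) (lambda : C) : Prop :=
  exists U : field, D U /\ ~ feq U fzero /\ feq (A U) (fscal lambda U).

Definition eigenvalue : (field -> field) -> C -> Prop := eigenvalue_in admissible.

Definition imag (omega : R) : C := Cmult Ci (RtoC omega).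

Inductive pm : Set := pm_plus | pm_minus.

(* om s m is omega_{ac,m}^s. *)
Definition acoustic_frequencies (om : pm -> nat -> R) : Prop :=
  (forall s, om s 0%nat = 0) /\
  (forall s m, Rabs (om s m) < Rabs (om s (S m))) /\
  (forall m, om pm_plus m = - om pm_minus m) /\
  (forall lambda : C,
     eigenvalue La lambda <-> exists s m, lambda = imag (om s m)).

Definition wave_number : Type := (Z * Z * Z)%type.

Definition horizontal_mode (k1 k2 : Z) (x y : R) : C :=
  let t := 2 * PI * (IZR k1 * x + IZR k2 * y) in (cos t, sin t).

Definition cos_mode (k : wave_number) : scalar := fun x y z =>
  let '(k1, k2, k3) := k in
  Cmult (horizontal_mode k1 k2 x y) (RtoC (cos (2 * PI * IZR k3 * z))).

Definition sin_mode (k : wave_number) : scalar := fun x y z =>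
  let '(k1, k2, k3) := k in
  Cmult (horizontal_mode k1 k2 x y) (RtoC (sin (2 * PI * IZR k3 * z))).

(* The parity conditions couple the vertical wave numbers k3 and -k3: even
   components carry a cosine in z and odd components a sine. *)
Definition has_wave_number (k : wave_number) (U : field) : Prop :=
  exists a b c d e : C,
    feq U (Field (sscal a (cos_mode k)) (sscal b (sin_mode k))
                 (sscal c (cos_mode k)) (sscal d (cos_mode k))
                 (sscal e (sin_mode k))).

Definition eigenvalue_at (k : wave_number) : (field -> field) -> C -> Prop :=
  eigenvalue_in (fun U => admissible U /\ has_wave_number k U).

(* |f| is of exact order g as eps -> 0+. The lower bound is what separates the
   families below: an upper bound alone would let each contain the previous one. *)
Definition same_order (f g : R -> R) : Prop :=
  exists c M : R, 0 < c /\ 0 < M /\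
    at_right 0 (fun eps => c * g eps <= Rabs (f eps) <= M * g eps).

(* At each wave number k, a family contributes at most one frequency up to sign,
   as a function of eps; the predicates Kmf, Kgw, Kaw tell at which wave numbers
   the family is present (internal waves, e.g., need k3 <> 0). *)
Definition three_families (nu : R) : Prop :=
  exists (Kmf Kgw Kaw : wave_number -> Prop)
         (iota_mf iota_gw iota_aw : wave_number -> R -> R),
    (exists k, Kmf k) /\ (exists k, Kgw k) /\ (exists k, Kaw k) /\
    (forall k, Kmf k -> forall eps, 0 < eps < 1 -> Rabs (iota_mf k eps) = 0) /\
    (forall k, Kgw k -> same_order (iota_gw k) (fun eps => Rpower eps (- nu))) /\
    (forall k, Kaw k -> same_order (iota_aw k) (fun eps => Rpower eps (- 1))) /\
    forall eps, 0 < eps < 1 ->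
      (forall lambda, eigenvalue (L_full nu eps) lambda ->
         exists k iota, lambda = imag iota /\ eigenvalue_at k (L_full nu eps) lambda) /\
      (forall k iota,
         eigenvalue_at k (L_full nu eps) (imag iota) <->
         (Kmf k /\ Rabs iota = Rabs (iota_mf k eps)) \/
         (Kgw k /\ Rabs iota = Rabs (iota_gw k eps)) \/
         (Kaw k /\ Rabs iota = Rabs (iota_aw k eps))).

(* Main.v *)
Require Import Defs.
From Stdlib Require Import Reals ZArith List Lra Lia.
From Stdlib Require Import Classical ClassicalEpsilon FunctionalExtensionality.
From Coquelicot Require Import Coquelicot.
Open Scope R_scope.

(** The modes with horizontal phase [exp (2 i pi (k1 x + k2 y))] and vertical profile
    [cos (2 pi k3 z)] or [sin (2 pi k3 z)] form a complete system: a periodic continuous function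
    with vanishing Fourier coefficients is zero, as one sees by integrating it against powers of
    a trigonometric polynomial that peaks at a given point. Integrating an eigenfunction against
    a mode (integration by parts moves the derivatives onto the mode) gives a solution of a 5 x 5
    linear system, so every eigenvalue of [al L_a + be L_g] lives at some wave number. There a
    nonzero eigenvalue [i w] satisfies, when [k3 <> 0],
      [w^4 - (al^2 |K|^2 + be^2) w^2 + al^2 be^2 |K_h|^2 = 0], where [K = 2 pi k],
    whose roots [X- <= X+] in [w^2] obey [0 <= X- <= be^2] and
    [al^2 |K|^2 <= X+ <= al^2 |K|^2 + be^2]. These are the internal and acoustic waves. *)

(** * Complex-valued integrals over a period *)

(** Eigenvalues are arbitrary complex numbers at the outset. That they are imaginary is not taken
    from anti-symmetry but read off from [l^2 = - X-] or [l^2 = - X+], with real nonnegative roots.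
    The bounds on these roots come from one identity: the discriminant equals [(al^2 |K|^2 - be^2)^2
    + 4 al^2 be^2 (2 pi k3)^2]. The lower bound that separates internal waves from the mean flow
    comes from the product of the roots, which vanishes with [K_h]. The plane [k3 = 0] is treated
    apart: its sine modes are zero, so gravity has nothing to act on and only the purely acoustic
    root remains. Parity shapes the Fourier analysis: uniqueness on a period needs all exponentials,
    but an even or odd field is tested against one kind of profile only, and a reflection disposes
    of the other kind. *)

Lemma continuous_C {T : UniformSpace} (f : T -> C) (t : T) :
  @continuous T C_UniformSpace f t <->
  continuous (fun s => Re (f s)) t /\ continuous (fun s => Im (f s)) t.
Proof.
  split.
  - intros H; split.
    + exact (continuous_comp f fst t H (continuous_fst (fst (f t)) (snd (f t)))).
    + exact (continuous_comp f snd t H (continuous_snd (fst (f t)) (snd (f t)))).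
  - intros [H1 H2].
    intros P [e He].
    assert (Q1 := H1 _ (locally_ball (Re (f t)) e)).
    assert (Q2 := H2 _ (locally_ball (Im (f t)) e)).
    unfold filtermap in *.
    apply (filter_imp _ _) with (2 := filter_and _ _ Q1 Q2).
    intros s [A B]; apply He; split; assumption.
Qed.

Lemma continuous_pair {T U V : UniformSpace} (f : T -> U) (g : T -> V) (t : T) :
  continuous f t -> continuous g t ->
  @continuous T (prod_UniformSpace U V) (fun s => (f s, g s)) t.
Proof.
  intros H1 H2 P [e He].
  assert (Q1 := H1 _ (locally_ball (f t) e)).
  assert (Q2 := H2 _ (locally_ball (g t) e)).
  unfold filtermap in *.
  apply (filter_imp _ _) with (2 := filter_and _ _ Q1 Q2).
  intros s [A B]; apply He; split; assumption.
Qed.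

Definition contC {T : UniformSpace} (f : T -> C) : Prop :=
  forall t, @continuous T C_UniformSpace f t.

Definition cont3 (f : scalar) : Prop :=
  @contC (prod_UniformSpace (prod_UniformSpace R_UniformSpace R_UniformSpace)
                            R_UniformSpace)
    (fun p => f (fst (fst p)) (snd (fst p)) (snd p)).

Lemma contC_Re {T : UniformSpace} (f : T -> C) (t : T) :
  contC f -> continuous (fun s => Re (f s)) t.
Proof. intros H; apply (proj1 (continuous_C f t) (H t)). Qed.

Lemma contC_Im {T : UniformSpace} (f : T -> C) (t : T) :
  contC f -> continuous (fun s => Im (f s)) t.
Proof. intros H; apply (proj1 (continuous_C f t) (H t)). Qed.

Lemma contC_plus {T : UniformSpace} (f g : T -> C) :
  contC f -> contC g -> contC (fun t => Cplus (f t) (g t)).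
Proof.
  intros Hf Hg t; apply continuous_C; split; simpl.
  - apply (continuous_plus (fun s => Re (f s)) (fun s => Re (g s))); now apply contC_Re.
  - apply (continuous_plus (fun s => Im (f s)) (fun s => Im (g s))); now apply contC_Im.
Qed.

Lemma contC_mult {T : UniformSpace} (f g : T -> C) :
  contC f -> contC g -> contC (fun t => Cmult (f t) (g t)).
Proof.
  intros Hf Hg t; apply continuous_C.
  assert (A := contC_Re f t Hf). assert (B := contC_Im f t Hf).
  assert (A' := contC_Re g t Hg). assert (B' := contC_Im g t Hg).
  split; unfold Cmult; simpl.
  - apply (continuous_minus (fun s => Re (f s) * Re (g s)) (fun s => Im (f s) * Im (g s)));
      now apply @continuous_mult.
  - apply (continuous_plus (fun s => Re (f s) * Im (g s)) (fun s => Im (f s) * Re (g s)));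
      now apply @continuous_mult.
Qed.

Lemma contC_const {T : UniformSpace} (c : C) : contC (fun _ : T => c).
Proof. intros t; apply continuous_const. Qed.

Lemma contC_comp {T U : UniformSpace} (f : T -> U) (g : U -> C) :
  (forall t, continuous f t) -> contC g -> contC (fun t => g (f t)).
Proof. intros Hf Hg t; apply continuous_comp; auto. Qed.

Lemma contC_RtoC {T : UniformSpace} (f : T -> R) :
  (forall t, continuous f t) -> contC (fun t => RtoC (f t)).
Proof. intros H t; apply continuous_C; split; simpl; auto using continuous_const. Qed.

Lemma cont3_comp {T : UniformSpace} (f : scalar) (a b c : T -> R) :
  cont3 f -> (forall t, continuous a t) -> (forall t, continuous b t) ->
  (forall t, continuous c t) -> contC (fun t => f (a t) (b t) (c t)).
Proof.
  intros Hf Ha Hb Hc.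
  apply (contC_comp (fun t => ((a t, b t), c t)) _) with (2 := Hf).
  intros t; apply continuous_pair; auto; apply continuous_pair; auto.
Qed.

Definition cint (f : R -> C) : C :=
  (RInt (fun x => Re (f x)) 0 1, RInt (fun x => Im (f x)) 0 1).

Lemma cint_ext (f g : R -> C) : (forall x, f x = g x) -> cint f = cint g.
Proof. intros H; replace g with f; auto; now apply functional_extensionality. Qed.

Lemma ex_RInt_cont (f : R -> R) a b : (forall x, continuous f x) -> ex_RInt f a b.
Proof. intros H; apply (@ex_RInt_continuous R_CompleteNormedModule); auto. Qed.

Lemma cint_plus (f g : R -> C) : contC f -> contC g ->
  cint (fun x => Cplus (f x) (g x)) = Cplus (cint f) (cint g).
Proof.
  intros Hf Hg; unfold cint, Cplus; simpl; f_equal.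
  - apply (RInt_plus (fun x => Re (f x)) (fun x => Re (g x)));
      apply ex_RInt_cont; intros; now apply contC_Re.
  - apply (RInt_plus (fun x => Im (f x)) (fun x => Im (g x)));
      apply ex_RInt_cont; intros; now apply contC_Im.
Qed.

Lemma cint_scal (c : C) (f : R -> C) : contC f ->
  cint (fun x => Cmult c (f x)) = Cmult c (cint f).
Proof.
  intros Hf.
  assert (Er : ex_RInt (fun x => Re (f x)) 0 1)
    by (apply ex_RInt_cont; intros; now apply contC_Re).
  assert (Ei : ex_RInt (fun x => Im (f x)) 0 1)
    by (apply ex_RInt_cont; intros; now apply contC_Im).
  unfold cint, Cmult; simpl; f_equal; apply is_RInt_unique.
  - apply @is_RInt_minus; apply @is_RInt_scal; now apply (RInt_correct (V:=R_CompleteNormedModule)).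
  - apply @is_RInt_plus; apply @is_RInt_scal; now apply (RInt_correct (V:=R_CompleteNormedModule)).
Qed.

Lemma cint_0 : cint (fun _ => RtoC 0) = RtoC 0.
Proof.
  unfold cint; simpl; rewrite !RInt_const. unfold RtoC; f_equal; apply Rmult_0_r.
Qed.

(** Only the integration variable ranges over a compact set, so [T] can be any uniform space; a pair
    of parameters is then as good as one. *)
Lemma RInt_param_continuous {T : UniformSpace} (g : R -> T -> R) :
  (forall p : R * T, @continuous (prod_UniformSpace R_UniformSpace T) R_UniformSpace
     (fun p => g (fst p) (snd p)) p) ->
  forall t, continuous (fun t => RInt (fun x => g x t) 0 1) t.
Proof.
  intros H t.
  assert (Hx : forall t x, continuous (fun x => g x t) x).
  { intros s x. apply (continuous_comp (fun x => (x, s)) (fun p => g (fst p) (snd p))).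
    - apply continuous_pair; [apply continuous_id | apply continuous_const].
    - apply H. }
  intros P [e He].
  (* Two comparisons with the centre of a ball, at [s] and at [t], cost [e / 4] each; the total
     [e / 2] leaves room for a strict inequality after integration. *)
  assert (D : forall x, exists d : posreal, forall x' s, Rabs (x' - x) < d -> ball t d s ->
             Rabs (g x' s - g x t) < e / 4).
  { intros x. assert (e4 : 0 < e / 4) by (destruct e; simpl; lra).
    destruct (H (x, t) _ (locally_ball _ (mkposreal _ e4))) as [d Hd].
    exists d; intros x' s A B. apply (Hd (x', s)). split; assumption. }
  pose (dl x := proj1_sig (constructive_indefinite_description _ (D x))).
  assert (Dl : forall x x' s, Rabs (x' - x) < dl x -> ball t (dl x) s ->
             Rabs (g x' s - g x t) < e / 4)
    by (intros x; exact (proj2_sig (constructive_indefinite_description _ (D x)))).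
  clearbody dl.
  (* Compactness of [0, 1] turns the radii [dl x] into a single one, valid for every [x]. *)
  destruct (compactness_value_1d 0 1 dl) as [d Hd].
  exists d; intros s Hs; apply He.
  assert (C : forall x, 0 <= x <= 1 -> Rabs (g x s - g x t) <= e / 2).
  { intros x hx. apply NNPP; intros N. apply (Hd x hx); intros [y [_ [hy hd]]]; apply N.
    assert (A := Dl y x s hy (ball_le _ _ _ hd _ Hs)).
    assert (B := Dl y x t hy (ball_center _ _)).
    replace (g x s - g x t) with ((g x s - g y t) - (g x t - g y t)) by ring.
    eapply Rle_trans; [apply Rabs_triang|]; rewrite Rabs_Ropp; lra. }
  change (Rabs (minus (RInt (fun x => g x s) 0 1) (RInt (fun x => g x t) 0 1)) < e).
  rewrite <- (RInt_minus (fun x => g x s) (fun x => g x t)) by (apply ex_RInt_cont; auto).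
  assert (Em : forall a b, ex_RInt (fun x => minus (g x s) (g x t)) a b)
    by (intros; apply ex_RInt_cont; intros; apply @continuous_minus; auto).
  apply Rle_lt_trans with (e / 2); [|destruct e; simpl; lra].
  replace (e / 2) with ((1 - 0) * (e / 2)) by ring.
  apply (norm_RInt_le_const (fun x => minus (g x s) (g x t))); [lra| exact C |].
  apply (RInt_correct (V := R_CompleteNormedModule)); auto.
Qed.

Lemma cint_param_continuous {T : UniformSpace} (g : R -> T -> C) :
  @contC (prod_UniformSpace R_UniformSpace T) (fun p => g (fst p) (snd p)) ->
  contC (fun t => cint (fun x => g x t)).
Proof.
  intros H t; apply continuous_C; split; simpl.
  - apply (RInt_param_continuous (fun x t => Re (g x t))); intros p; apply (contC_Re _ p H).
  - apply (RInt_param_continuous (fun x t => Im (g x t))); intros p; apply (contC_Im _ p H).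
Qed.

(** Componentwise, to match [CDerive] and [cint]; unlike [CDerive] it also asserts that the
    derivative exists. *)
Definition is_cderive (f : R -> C) (t : R) (l : C) : Prop :=
  is_derive (fun s => Re (f s)) t (Re l) /\ is_derive (fun s => Im (f s)) t (Im l).

Lemma RInt_param_derive (g dg : R -> R -> R) (t : R) :
  (forall x t, is_derive (g x) t (dg x t)) ->
  (forall p : R * R, continuous (fun p => dg (fst p) (snd p)) p) ->
  (forall t x, continuous (fun x => g x t) x) ->
  is_derive (fun t => RInt (fun x => g x t) 0 1) t (RInt (fun x => dg x t) 0 1).
Proof.
  intros H Hd Hc.
  rewrite (RInt_ext (fun x => dg x t) (fun x => Derive (fun u => g x u) t))
    by (intros; symmetry; apply is_derive_unique, H).
  apply (is_derive_RInt_param (fun t x => g x t)).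
  - apply filter_forall; intros s x _; eexists; apply H.
  - intros x _ e.
    destruct (Hd (x, t) _ (locally_ball _ e)) as [d Hd'].
    exists d; intros u v hu hv.
    rewrite !(is_derive_unique _ _ _ (H _ _)).
    apply (Hd' (v, u)); split; assumption.
  - apply filter_forall; intros s; apply ex_RInt_cont; auto.
Qed.

Lemma cint_param_derive (g dg : R -> R -> C) (t : R) :
  (forall x t, is_cderive (g x) t (dg x t)) ->
  contC (fun p : R * R => dg (fst p) (snd p)) ->
  (forall t, contC (fun x => g x t)) ->
  is_cderive (fun t => cint (fun x => g x t)) t (cint (fun x => dg x t)).
Proof.
  intros H Hd Hc; split; simpl.
  - apply (RInt_param_derive (fun x t => Re (g x t)) (fun x t => Re (dg x t))).
    + intros; apply H.
    + intros p; apply (contC_Re _ p Hd).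
    + intros; now apply contC_Re.
  - apply (RInt_param_derive (fun x t => Im (g x t)) (fun x t => Im (dg x t))).
    + intros; apply H.
    + intros p; apply (contC_Im _ p Hd).
    + intros; now apply contC_Im.
Qed.

Lemma cint_is_cderive (h dh : R -> C) :
  (forall t, is_cderive h t (dh t)) -> contC dh -> h 1 = h 0 -> cint dh = RtoC 0.
Proof.
  intros H Hc E; unfold cint, RtoC; f_equal; apply is_RInt_unique.
  - replace 0 with (minus (Re (h 1)) (Re (h 0))) at 2
      by (rewrite E; apply (minus_eq_zero (G := R_AbelianGroup))).
    apply (is_RInt_derive (V := R_CompleteNormedModule) (fun t => Re (h t)) (fun t => Re (dh t)));
      intros; [apply H | now apply contC_Re].
  - replace 0 with (minus (Im (h 1)) (Im (h 0))) at 2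
      by (rewrite E; apply (minus_eq_zero (G := R_AbelianGroup))).
    apply (is_RInt_derive (V := R_CompleteNormedModule) (fun t => Im (h t)) (fun t => Im (dh t)));
      intros; [apply H | now apply contC_Im].
Qed.

(** * Integration by parts on the torus *)

Definition torus_int (f : scalar) : C :=
  cint (fun z => cint (fun y => cint (fun x => f x y z))).

(** The regularity that one integration by parts uses. Its stability under products takes a single
    product rule, whereas [smooth] would involve iterated derivatives. *)
Definition C1_periodic (f : scalar) : Prop :=
  periodic f /\ cont3 f /\ forall i, cont3 (partial i f) /\
    forall x y z, is_cderive (line i f x y z) (coordinate i x y z) (partial i f x y z).

Lemma C1_periodic_cont3 (f : scalar) : C1_periodic f -> cont3 f.
Proof. exact (fun H => proj1 (proj2 H)). Qed.

Definition smul (f g : scalar) : scalar := fun x y z => Cmult (f x y z) (g x y z).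

Lemma cont3_int_x (f : scalar) : cont3 f ->
  contC (fun p : R * R => cint (fun x => f x (fst p) (snd p))).
Proof.
  intros H; apply (cint_param_continuous (fun x (p : R * R) => f x (fst p) (snd p))).
  apply (cont3_comp f (fun p : R * (R * R) => fst p) (fun p => fst (snd p)) (fun p => snd (snd p))); auto.
  - intros [u v]; apply continuous_fst.
  - intros [u [v w]]; apply (continuous_comp snd fst); [apply continuous_snd | apply continuous_fst].
  - intros [u [v w]]; apply (continuous_comp snd snd); [apply continuous_snd | apply continuous_snd].
Qed.

Lemma contC_left (g : R -> R -> C) : contC (fun p : R * R => g (fst p) (snd p)) ->
  forall s, contC (fun t => g t s).
Proof.
  intros H s; apply (contC_comp (fun t => (t, s)) (fun p : R * R => g (fst p) (snd p))); auto.
  intros t; apply continuous_pair; [apply continuous_id | apply continuous_const].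
Qed.

Lemma cont3_int_xy (f : scalar) : cont3 f ->
  contC (fun z => cint (fun y => cint (fun x => f x y z))).
Proof.
  intros H; apply (cint_param_continuous (fun y z => cint (fun x => f x y z))).
  exact (cont3_int_x f H).
Qed.

Lemma cont3_x (f : scalar) y z : cont3 f -> contC (fun x => f x y z).
Proof. intros H; apply cont3_comp; auto; intros; try apply continuous_const; apply continuous_id. Qed.

Lemma cont3_plus f g : cont3 f -> cont3 g -> cont3 (sadd f g).
Proof. intros; now apply contC_plus. Qed.

Lemma cont3_mul f g : cont3 f -> cont3 g -> cont3 (smul f g).
Proof. intros; now apply contC_mult. Qed.

Lemma torus_int_plus f g : cont3 f -> cont3 g ->
  torus_int (sadd f g) = Cplus (torus_int f) (torus_int g).
Proof.
  intros Hf Hg; unfold torus_int, sadd.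
  rewrite <- cint_plus by now apply cont3_int_xy.
  apply cint_ext; intros z.
  rewrite <- cint_plus; try (now apply (contC_left (fun y z => cint (fun x => _ x y z))), cont3_int_x).
  apply cint_ext; intros y.
  apply cint_plus; now apply cont3_x.
Qed.

Lemma torus_int_scal c f : cont3 f -> torus_int (sscal c f) = Cmult c (torus_int f).
Proof.
  intros Hf; unfold torus_int, sscal.
  rewrite <- cint_scal by now apply cont3_int_xy.
  apply cint_ext; intros z.
  rewrite <- cint_scal by (now apply (contC_left (fun y z => cint (fun x => f x y z))), cont3_int_x).
  apply cint_ext; intros y.
  apply cint_scal; now apply cont3_x.
Qed.

Lemma torus_int_0 : torus_int szero = RtoC 0.
Proof. unfold torus_int, szero. now rewrite !cint_0. Qed.

(** The fundamental theorem of calculus over one period. For y and z the derivative is first pulled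
    out of the inner integrals by differentiation under the integral sign. *)
Lemma torus_int_partial (i : axis) (f : scalar) : C1_periodic f -> torus_int (partial i f) = RtoC 0.
Proof.
  intros [Hp [Hc Hd]]; destruct (Hd i) as [Hic Hid].
  assert (P0 : forall y z, f 1 y z = f 0 y z)
    by (intros; rewrite <- (Rplus_0_l 1); apply Hp).
  assert (P1 : forall x z, f x 1 z = f x 0 z)
    by (intros; rewrite <- (Rplus_0_l 1); apply Hp).
  assert (P2 : forall x y, f x y 1 = f x y 0)
    by (intros; rewrite <- (Rplus_0_l 1); apply Hp).
  unfold torus_int; destruct i; simpl in Hid.
  - rewrite <- cint_0; apply cint_ext; intros z.
    rewrite <- cint_0; apply cint_ext; intros y.
    apply (cint_is_cderive (fun x => f x y z)); auto.
    now apply cont3_x.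
  - rewrite <- cint_0; apply cint_ext; intros z.
    apply (cint_is_cderive (fun y => cint (fun x => f x y z))).
    + intros y; apply (cint_param_derive (fun x y => f x y z) (fun x y => partial axis_y f x y z)).
      * intros; apply Hid.
      * apply cont3_comp; auto; intros; try apply continuous_const;
          destruct t; [apply continuous_fst | apply continuous_snd].
      * intros; now apply cont3_x.
    + apply (contC_left (fun y z => cint (fun x => partial axis_y f x y z))), cont3_int_x, Hic.
    + apply cint_ext; auto.
  - apply (cint_is_cderive (fun z => cint (fun y => cint (fun x => f x y z)))).
    + intros z; apply (cint_param_derive (fun y z => cint (fun x => f x y z))
                         (fun y z => cint (fun x => partial axis_z f x y z))).
      * intros y s. apply (cint_param_derive (fun x z => f x y z) (fun x z => partial axis_z f x y z)).
        -- intros; apply Hid.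
        -- apply cont3_comp; auto; intros; try apply continuous_const;
          destruct t; [apply continuous_fst | apply continuous_snd].
        -- intros; now apply cont3_x.
      * now apply cont3_int_x.
      * apply contC_left; now apply cont3_int_x.
    + now apply cont3_int_xy.
    + apply cint_ext; intros; apply cint_ext; auto.
Qed.

Lemma is_cderive_mult (f g : R -> C) t l m : is_cderive f t l -> is_cderive g t m ->
  is_cderive (fun s => Cmult (f s) (g s)) t (Cplus (Cmult l (g t)) (Cmult (f t) m)).
Proof.
  intros [F1 F2] [G1 G2]; split; unfold Cmult, Re, Im in *; simpl.
  - replace (fst l * fst (g t) - snd l * snd (g t) + (fst (f t) * fst m - snd (f t) * snd m))
      with ((fst l * fst (g t) + fst (f t) * fst m) - (snd l * snd (g t) + snd (f t) * snd m)) by ring.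
    apply @is_derive_minus; apply @is_derive_mult; auto; apply Rmult_comm.
  - replace (fst l * snd (g t) + snd l * fst (g t) + (fst (f t) * snd m + snd (f t) * fst m))
      with ((fst l * snd (g t) + fst (f t) * snd m) + (snd l * fst (g t) + snd (f t) * fst m)) by ring.
    apply @is_derive_plus; apply @is_derive_mult; auto; apply Rmult_comm.
Qed.

Lemma is_cderive_CDerive f t l : is_cderive f t l -> CDerive f t = l.
Proof.
  intros [A B]; destruct l; unfold CDerive; f_equal; now apply is_derive_unique.
Qed.

Lemma is_cderive_smul i f g x y z : C1_periodic f -> C1_periodic g ->
  is_cderive (line i (smul f g) x y z) (coordinate i x y z)
    (Cplus (Cmult (partial i f x y z) (g x y z)) (Cmult (f x y z) (partial i g x y z))).
Proof.
  intros [_ [_ Hf]] [_ [_ Hg]].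
  assert (F := proj2 (Hf i) x y z). assert (G := proj2 (Hg i) x y z).
  assert (H := is_cderive_mult _ _ _ _ _ F G).
  destruct i; exact H.
Qed.

Lemma partial_smul i f g : C1_periodic f -> C1_periodic g ->
  partial i (smul f g) = sadd (smul (partial i f) g) (smul f (partial i g)).
Proof.
  intros Hf Hg; do 3 (apply functional_extensionality; intro).
  apply is_cderive_CDerive; now apply is_cderive_smul.
Qed.

Lemma C1_periodic_smul f g : C1_periodic f -> C1_periodic g -> C1_periodic (smul f g).
Proof.
  intros Hf Hg.
  assert (Hf' := Hf); assert (Hg' := Hg).
  destruct Hf' as [pf [cf df]], Hg' as [pg [cg dg]]; split; [|split].
  - intros x y z; unfold smul; destruct (pf x y z) as [-> [-> ->]], (pg x y z) as [-> [-> ->]]; auto.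
  - now apply cont3_mul.
  - intros i; rewrite partial_smul; auto; split.
    + apply cont3_plus; apply cont3_mul; auto; [apply df | apply dg].
    + intros; now apply is_cderive_smul.
Qed.

Lemma integration_by_parts i f g : C1_periodic f -> C1_periodic g ->
  torus_int (smul (partial i f) g) = Copp (torus_int (smul f (partial i g))).
Proof.
  intros Hf Hg.
  assert (H := torus_int_partial i _ (C1_periodic_smul _ _ Hf Hg)).
  rewrite partial_smul, torus_int_plus in H; auto.
  - replace (torus_int (smul (partial i f) g)) with
      (Cminus (Cplus (torus_int (smul (partial i f) g)) (torus_int (smul f (partial i g))))
        (torus_int (smul f (partial i g)))) by ring.
    rewrite H; ring.
  - exact (cont3_mul _ _ (proj1 (proj2 (proj2 Hf) i)) (C1_periodic_cont3 g Hg)).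
  - exact (cont3_mul _ _ (C1_periodic_cont3 f Hf) (proj1 (proj2 (proj2 Hg) i))).
Qed.

Lemma smooth_C1_periodic f : periodic f -> smooth f -> C1_periodic f.
Proof.
  intros Hp Hs; split; [|split]; auto.
  - intros [[x y] z]; apply (Hs nil x y z).
  - intros i; split.
    + intros [[x y] z]; apply (Hs (i :: nil) x y z).
    + intros x y z; destruct (proj2 (Hs nil x y z) i) as [l Hl]; simpl in Hl.
      assert (D : is_cderive (line i f x y z) (coordinate i x y z) l).
      { split.
        - exact (filterdiff_comp _ _ _ _ Hl (filterdiff_linear _
            (is_linear_fst (K:=R_AbsRing) (U:=R_NormedModule) (V:=R_NormedModule)))).
        - exact (filterdiff_comp _ _ _ _ Hl (filterdiff_linear _
            (is_linear_snd (K:=R_AbsRing) (U:=R_NormedModule) (V:=R_NormedModule)))). }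
      unfold partial; now rewrite (is_cderive_CDerive _ _ _ D).
Qed.

(** * Uniqueness of Fourier coefficients *)

(** A trigonometric polynomial of degree one, shifted so that for [0 < d <= 1 / 2] it exceeds 1
    within distance [d] of [x0] and lies in [-1, 1] farther away, modulo the period. *)
Definition peak (d x0 x : R) : R := 1 - cos (2 * PI * d) + cos (2 * PI * (x - x0)).

Lemma cos_2PI_le a t : 0 <= a -> a <= t <= 1 - a -> cos (2 * PI * t) <= cos (2 * PI * a).
Proof.
  intros Ha Ht. assert (P := PI_RGT_0).
  destruct (Rle_dec t (1 / 2)).
  - apply cos_decr_1; nra.
  - replace (2 * PI * t) with (- (2 * PI * (1 - t)) + 2 * PI) by ring.
    rewrite cos_plus, cos_2PI, sin_2PI, cos_neg, Rmult_0_r, Rmult_1_r, Rminus_0_r.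
    apply cos_decr_1; nra.
Qed.

Lemma cos_2PI_abs t : cos (2 * PI * Rabs t) = cos (2 * PI * t).
Proof.
  unfold Rabs; destruct Rcase_abs; auto.
  replace (2 * PI * - t) with (- (2 * PI * t)) by ring; apply cos_neg.
Qed.

Lemma peak_ge d x0 x a : 0 <= Rabs (x - x0) <= a -> a <= d <= 1 / 2 ->
  1 + (cos (2 * PI * a) - cos (2 * PI * d)) <= peak d x0 x.
Proof.
  intros H1 H2; unfold peak; rewrite <- (cos_2PI_abs (x - x0)).
  assert (cos (2 * PI * a) <= cos (2 * PI * Rabs (x - x0))) by (apply cos_2PI_le; lra).
  lra.
Qed.

Lemma peak_abs_le d x0 x : 0 <= d -> d <= Rabs (x - x0) <= 1 - d -> Rabs (peak d x0 x) <= 1.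
Proof.
  intros H1 H2; unfold peak; rewrite <- (cos_2PI_abs (x - x0)).
  assert (cos (2 * PI * Rabs (x - x0)) <= cos (2 * PI * d)) by (apply cos_2PI_le; lra).
  assert (A := COS_bound (2 * PI * d)). assert (B := COS_bound (2 * PI * Rabs (x - x0))).
  apply Rabs_le; lra.
Qed.

Lemma peak_continuous d x0 x : continuous (peak d x0) x.
Proof.
  apply (ex_derive_continuous (V := R_NormedModule)).
  unfold peak; auto_derive; auto.
Qed.

Lemma pow_continuous (f : R -> R) n x : continuous f x -> continuous (fun x => f x ^ n) x.
Proof.
  intros H; induction n; simpl; [apply continuous_const|].
  now apply @continuous_mult.
Qed.

Lemma Rabs_continuous (f : R -> R) x : continuous f x -> continuous (fun x => Rabs (f x)) x.
Proof.
  intros H; apply (continuous_comp f Rabs); auto.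
  apply continuity_pt_filterlim, Rcontinuity_abs.
Qed.

(* The n-th powers of a peak that is > 1 near x0 and bounded by 1 in absolute value away from x0
   would make the integral unbounded. *)
Lemma peak_integral_separates (u : R -> R) (x0 : R) :
  (forall x, continuous u x) -> 0 < x0 < 1 ->
  (forall d n, RInt (fun x => u x * peak d x0 x ^ n) 0 1 = 0) -> u x0 <= 0.
Proof.
  intros Hc Hx H; apply Rnot_lt_le; intros Hu.
  assert (P := PI_RGT_0).
  assert (m0 : 0 < u x0 / 2) by lra.
  destruct (Hc x0 _ (locally_ball _ (mkposreal _ m0))) as [d0 Hd0].
  assert (Hm : forall x, Rabs (x - x0) < d0 -> u x0 / 2 <= u x).
  { intros x hx. specialize (Hd0 x hx).
    change (Rabs (u x - u x0) < u x0 / 2) in Hd0.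
    apply Rabs_def2 in Hd0; lra. }
  clear Hd0. set (m := u x0 / 2) in *.
  (* The last two conditions keep the window inside (0, 1) and give [Rabs (x - x0) <= 1 - d] on
     [0, 1], so the periodic copies of the peak stay out of the interval. *)
  assert (Dd : exists d, 0 < d /\ d < d0 /\ d < x0 /\ d < 1 - x0).
  { exists (Rmin d0 (Rmin x0 (1 - x0)) / 2).
    assert (A := Rmin_l d0 (Rmin x0 (1 - x0))). assert (B := Rmin_r d0 (Rmin x0 (1 - x0))).
    assert (A' := Rmin_l x0 (1 - x0)). assert (B' := Rmin_r x0 (1 - x0)).
    assert (0 < Rmin d0 (Rmin x0 (1 - x0))).
    { apply Rmin_pos; [apply cond_pos|]. apply Rmin_pos; lra. }
    lra. }
  destruct Dd as [d [Hd1 [Hd2 [Hd3 Hd4]]]]. clear Hx.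
  assert (d <= 1 / 2) by lra.
  set (a := d / 2). set (s := cos (2 * PI * a) - cos (2 * PI * d)).
  assert (Hs : 0 < s).
  { unfold s, a. assert (cos (2 * PI * d) < cos (2 * PI * (d / 2))); [|lra].
    apply cos_decreasing_1; nra. }
  set (F := fun n x => u x * peak d x0 x ^ n).
  assert (CF : forall n x, continuous (F n) x).
  { intros n x; apply @continuous_mult; auto. apply pow_continuous, peak_continuous. }
  assert (CA : forall x, continuous (fun x => Rabs (u x)) x) by (intros; now apply Rabs_continuous).
  assert (EA : forall p q, ex_RInt (fun x => Rabs (u x)) p q) by (intros; now apply ex_RInt_cont).
  assert (EF : forall n p q, ex_RInt (F n) p q) by (intros; now apply ex_RInt_cont).
  assert (EN : forall p q, ex_RInt (fun x => - Rabs (u x)) p q)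
    by (intros; apply (ex_RInt_opp (V := R_NormedModule)); auto).
  (* Inside the window [u] is positive and the peak at least 1; outside, the peak is at most 1 in
     absolute value. The lower bound is therefore independent of [n]. *)
  assert (Low : forall n x, 0 <= x <= 1 -> - Rabs (u x) <= F n x).
  { intros n x hx; unfold F.
    destruct (Rlt_dec (Rabs (x - x0)) d) as [L|L].
    - assert (A : 1 <= peak d x0 x).
      { assert (B := peak_ge d x0 x d). assert (C := Rabs_pos (x - x0)). lra. }
      assert (0 <= peak d x0 x ^ n) by (apply pow_le; lra).
      assert (B := Hm x). assert (C := Rabs_pos (u x)). nra.
    - assert (A : Rabs (peak d x0 x) <= 1).
      { apply peak_abs_le; [lra|]; split; [lra|]. apply Rabs_le; lra. }
      assert (B : Rabs (peak d x0 x ^ n) <= 1).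
      { rewrite <- RPow_abs. rewrite <- (pow1 n). apply pow_incr; split; [apply Rabs_pos|auto]. }
      assert (C : Rabs (u x * peak d x0 x ^ n) <= Rabs (u x)).
      { rewrite Rabs_mult. assert (D := Rabs_pos (u x)). nra. }
      assert (D := Rabs_maj2 (u x * peak d x0 x ^ n)). lra. }
  assert (Side : forall n p q, 0 <= p -> p <= q -> q <= 1 ->
            - RInt (fun x => Rabs (u x)) p q <= RInt (F n) p q).
  { intros n p q h1 h2 h3.
    rewrite <- (RInt_opp (V := R_CompleteNormedModule)) by auto.
    apply RInt_le; auto. intros; apply Low; lra. }
  (* On the half-size window, of length [2 * a = d], the peak is at least [1 + s]: geometric growth
     in [n]. *)
  assert (Mid : forall n, m * (1 + s) ^ n * d <= RInt (F n) (x0 - a) (x0 + a)).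
  { intros n.
    replace (m * (1 + s) ^ n * d) with (RInt (fun _ => m * (1 + s) ^ n) (x0 - a) (x0 + a)).
    2:{ rewrite RInt_const. unfold scal; simpl; unfold mult; simpl. unfold a; field. }
    unfold a in *.
    apply RInt_le; auto; [lra| apply ex_RInt_const |].
    intros x hx.
    assert (Hxa : Rabs (x - x0) <= d / 2) by (apply Rabs_le; lra).
    assert (Hp : 1 + s <= peak d x0 x).
    { apply peak_ge; [split; [apply Rabs_pos | auto] | lra]. }
    assert ((1 + s) ^ n <= peak d x0 x ^ n) by (apply pow_incr; lra).
    assert (0 <= (1 + s) ^ n) by (apply pow_le; lra).
    assert (m <= u x) by (apply Hm; lra).
    unfold F; nra. }
  set (I := RInt (fun x => Rabs (u x)) 0 (x0 - a) + RInt (fun x => Rabs (u x)) (x0 + a) 1).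
  assert (All : forall n, m * (1 + s) ^ n * d <= I).
  { intros n. assert (E := H d n). fold (F n) in E. change (RInt (F n) 0 1 = 0) in E.
    rewrite <- (RInt_Chasles (F n) 0 (x0 - a) 1) in E by auto.
    rewrite <- (RInt_Chasles (F n) (x0 - a) (x0 + a) 1) in E by auto.
    unfold plus in E; simpl in E.
    assert (S1 := Side n 0 (x0 - a)). assert (S2 := Side n (x0 + a) 1).
    assert (M := Mid n). unfold I, a in *. lra. }
  (* Bernoulli's inequality [poly] gives [(1 + s) ^ n >= 1 + n s], so this [n] already violates the
     bound by [I]. *)
  destruct (INR_unbounded (I / (m * d * s))) as [n Hn].
  assert (B := poly n s Hs). assert (A := All n).
  assert (md : 0 < m * d * s) by (apply Rmult_lt_0_compat; auto; apply Rmult_lt_0_compat; auto).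
  apply (Rmult_lt_compat_r (m * d * s)) in Hn; auto.
  unfold Rdiv in Hn; rewrite Rmult_assoc, Rinv_l, Rmult_1_r in Hn by lra.
  assert (m * d * (1 + INR n * s) <= m * d * (1 + s) ^ n).
  { apply Rmult_le_compat_l; auto. apply Rlt_le, Rmult_lt_0_compat; auto. }
  assert (0 < m * d) by now apply Rmult_lt_0_compat.
  nra.
Qed.

Definition cis (t : R) : C := (cos t, sin t).

Lemma cis_plus s t : cis (s + t) = Cmult (cis s) (cis t).
Proof. unfold cis, Cmult; simpl; rewrite cos_plus, sin_plus; f_equal; ring. Qed.

Lemma contC_cis {T : UniformSpace} (f : T -> R) :
  (forall t, continuous f t) -> contC (fun t => cis (f t)).
Proof.
  intros H t; apply continuous_C; split; simpl.
  - apply (continuous_comp f cos); auto. apply continuity_pt_filterlim, continuity_cos.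
  - apply (continuous_comp f sin); auto. apply continuity_pt_filterlim, continuity_sin.
Qed.

Lemma continuous_linear c x : continuous (fun x => c * x) x.
Proof.
  apply (continuous_mult (fun _ => c) (fun x => x)); [apply continuous_const | apply continuous_id].
Qed.

Lemma contC_cis_linear c : contC (fun x => cis (c * x)).
Proof. apply contC_cis; intros; apply continuous_linear. Qed.

(** Euler's formula, written so that multiplying by the peak shifts a frequency by 0, 1 or -1. *)
Lemma peak_cis d x0 x : RtoC (peak d x0 x) =
  Cplus (RtoC (1 - cos (2 * PI * d)))
    (Cplus (Cmult (Cmult (RtoC (/ 2)) (cis (- (2 * PI * x0)))) (cis (2 * PI * 1 * x)))
           (Cmult (Cmult (RtoC (/ 2)) (cis (2 * PI * x0))) (cis (2 * PI * (-1) * x)))).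
Proof.
  rewrite <- !Cmult_assoc, <- !cis_plus.
  replace (- (2 * PI * x0) + 2 * PI * 1 * x) with (2 * PI * (x - x0)) by ring.
  replace (2 * PI * x0 + 2 * PI * -1 * x) with (- (2 * PI * (x - x0))) by ring.
  unfold peak, cis, RtoC, Cmult, Cplus; simpl; rewrite cos_neg, sin_neg; f_equal; lra.
Qed.

(** Each factor of the peak mixes the frequencies [k - 1], [k] and [k + 1]; the induction on [n]
    closes because the claim is made for all [k] at once. *)
Lemma cint_peak_pow (h : R -> C) (d x0 : R) : contC h ->
  (forall k : Z, cint (fun x => Cmult (h x) (cis (2 * PI * IZR k * x))) = RtoC 0) ->
  forall n (k : Z), cint (fun x => Cmult (Cmult (h x) (RtoC (peak d x0 x ^ n)))
                                     (cis (2 * PI * IZR k * x))) = RtoC 0.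
Proof.
  intros Hc H n; induction n; intros k.
  - rewrite <- (H k); apply cint_ext; intros; simpl; ring.
  - set (c0 := RtoC (1 - cos (2 * PI * d))).
    set (c1 := Cmult (RtoC (/ 2)) (cis (- (2 * PI * x0)))).
    set (c2 := Cmult (RtoC (/ 2)) (cis (2 * PI * x0))).
    set (G := fun k x => Cmult (Cmult (h x) (RtoC (peak d x0 x ^ n))) (cis (2 * PI * IZR k * x))).
    assert (CG : forall k, contC (G k)).
    { intros j; apply contC_mult; [apply contC_mult; auto|apply contC_cis_linear].
      apply contC_RtoC; intros; apply pow_continuous, peak_continuous. }
    rewrite (cint_ext _ (fun x => Cplus (Cmult c0 (G k x))
       (Cplus (Cmult c1 (G (k + 1)%Z x)) (Cmult c2 (G (k + -1)%Z x))))).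
    2:{ intros x; unfold G; rewrite !plus_IZR.
        replace (2 * PI * (IZR k + 1) * x) with (2 * PI * IZR k * x + 2 * PI * 1 * x) by ring.
        replace (2 * PI * (IZR k + -1) * x) with (2 * PI * IZR k * x + 2 * PI * -1 * x) by ring.
        rewrite !cis_plus; simpl; rewrite RtoC_mult, peak_cis; fold c0 c1 c2; ring. }
    assert (CS : forall c k, contC (fun x => Cmult c (G k x)))
      by (intros; apply contC_mult; auto using contC_const).
    rewrite cint_plus, cint_plus, !cint_scal; auto using contC_plus.
    unfold G; rewrite !IHn; ring.
Qed.

Lemma fourier_Re_nonpos_interior (h : R -> C) (x0 : R) : contC h -> 0 < x0 < 1 ->
  (forall k : Z, cint (fun x => Cmult (h x) (cis (2 * PI * IZR k * x))) = RtoC 0) ->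
  Re (h x0) <= 0.
Proof.
  intros Hc Hx H.
  apply (peak_integral_separates (fun x => Re (h x)) x0); auto.
  - intros; now apply contC_Re.
  - intros d n. assert (E := cint_peak_pow h d x0 Hc H n 0).
    apply (f_equal Re) in E; simpl in E; etransitivity; [|exact E].
    apply RInt_ext; intros x _.
    replace (2 * PI * 0 * x) with 0 by ring; rewrite cos_0, sin_0; unfold Re.
    match goal with |- ?a = ?b => change (@eq R a b) end; ring.
Qed.

(** Vanishing coefficients survive multiplication by a constant, so the one-sided bound applies to
    [h] times 1, -1, i and -i, which pins both parts to 0. *)
Lemma fourier_zero_interior (h : R -> C) (x0 : R) : contC h -> 0 < x0 < 1 ->
  (forall k : Z, cint (fun x => Cmult (h x) (cis (2 * PI * IZR k * x))) = RtoC 0) ->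
  h x0 = RtoC 0.
Proof.
  intros Hc Hx H.
  assert (A : forall c, Re (Cmult c (h x0)) <= 0).
  { intros c; apply (fourier_Re_nonpos_interior (fun x => Cmult c (h x))); auto.
    - apply contC_mult; auto using contC_const.
    - intros k; rewrite (cint_ext _ (fun x => Cmult c (Cmult (h x) (cis (2 * PI * IZR k * x)))))
        by (intros; ring).
      rewrite cint_scal, H; [ring|]. apply contC_mult; auto; apply contC_cis_linear. }
  assert (A1 := A (1, 0)). assert (A2 := A (-1, 0)). assert (A3 := A (0, 1)). assert (A4 := A (0, -1)).
  clear A H Hc; destruct (h x0) as [p q]; simpl in *; unfold RtoC; f_equal; lra.
Qed.

Lemma periodic_Z {A : Type} (h : R -> A) : (forall x, h (x + 1) = h x) ->
  forall (n : Z) x, h (x + IZR n) = h x.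
Proof.
  intros H.
  assert (N : forall (n : nat) x, h (x + INR n) = h x).
  { induction n; intros x; [now rewrite Rplus_0_r|].
    rewrite S_INR, <- Rplus_assoc, H; auto. }
  intros n x; destruct (Z_le_dec 0 n).
  - rewrite <- (Z2Nat.id n), <- INR_IZR_INZ by auto; apply N.
  - rewrite <- (N (Z.to_nat (- n)) (x + IZR n)).
    f_equal. rewrite INR_IZR_INZ, Z2Nat.id, opp_IZR by lia; ring.
Qed.

(** The peak needs an interior point. The endpoint 0 follows by continuity and all other points by
    translation. *)
Lemma fourier_uniqueness (h : R -> C) : contC h -> (forall x, h (x + 1) = h x) ->
  (forall k : Z, cint (fun x => Cmult (h x) (cis (2 * PI * IZR k * x))) = RtoC 0) ->
  forall x, h x = RtoC 0.
Proof.
  intros Hc Hp H.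
  assert (H0 : h 0 = RtoC 0).
  { assert (Z : forall u : R -> R, continuous u 0 -> (forall t, 0 < t < 1 -> u t = 0) -> u 0 = 0).
    { intros u Hu Hz; apply NNPP; intros N.
      assert (Hpos : 0 < Rabs (u 0)) by now apply Rabs_pos_lt.
      destruct (Hu _ (locally_ball _ (mkposreal _ Hpos))) as [d Hd].
      set (t := Rmin d 1 / 2).
      assert (0 < t < 1 /\ t < d).
      { unfold t; assert (A := Rmin_l d 1); assert (B := Rmin_r d 1).
        assert (0 < Rmin d 1) by (apply Rmin_pos; [apply cond_pos | lra]). lra. }
      assert (B : Rabs (u t - u 0) < Rabs (u 0)).
      { apply Hd. change (Rabs (t - 0) < d). rewrite Rabs_pos_eq; lra. }
      rewrite Hz, Rminus_0_l, Rabs_Ropp in B; lra. }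
    rewrite (surjective_pairing (h 0)); unfold RtoC; f_equal.
    - apply (Z (fun t => Re (h t))); [now apply contC_Re|].
      intros; now rewrite fourier_zero_interior.
    - apply (Z (fun t => Im (h t))); [now apply contC_Im|].
      intros; now rewrite fourier_zero_interior. }
  (* [up x - 1] is the integer part of [x], so the translate of [x] lies in [0, 1). *)
  intros x. destruct (archimed x) as [A B].
  rewrite <- (periodic_Z h Hp (- (up x - 1)) x), opp_IZR, minus_IZR.
  destruct (Req_dec x (IZR (up x) - 1)) as [E|E].
  - now replace (x + - (IZR (up x) - 1)) with 0 by lra.
  - apply fourier_zero_interior; auto. split; lra.
Qed.

(** * Fourier modes *)

Definition freq (n : Z) : R := 2 * PI * IZR n.

(** The z-derivative exchanges cosine and sine modes; their span is stable under every partial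
    derivative, which thus becomes a linear map on [(A, B)]. *)
Definition trig_mode (k : wave_number) (A B : C) : scalar :=
  sadd (sscal A (cos_mode k)) (sscal B (sin_mode k)).

Lemma cis_2PI_period (t : R) (n : Z) : cis (2 * PI * (t + IZR n)) = cis (2 * PI * t).
Proof.
  apply (periodic_Z (fun t => cis (2 * PI * t))); intros x.
  unfold cis; replace (2 * PI * (x + 1)) with (2 * PI * x + 2 * PI) by ring.
  now rewrite cos_plus, sin_plus, cos_2PI, sin_2PI, !Rmult_0_r, !Rmult_1_r, Rminus_0_r, Rplus_0_r.
Qed.

Lemma cis_freq_period (n : Z) (t : R) : cis (2 * PI * IZR n * (t + 1)) = cis (2 * PI * IZR n * t).
Proof.
  replace (2 * PI * IZR n * (t + 1)) with (2 * PI * (IZR n * t + IZR n)) by ring.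
  rewrite cis_2PI_period; f_equal; ring.
Qed.

Lemma trig_mode_periodic k A B : periodic (trig_mode k A B).
Proof.
  destruct k as [[k1 k2] k3]; intros x y z.
  unfold trig_mode, sadd, sscal, cos_mode, sin_mode, horizontal_mode.
  assert (E1 : forall t, (cos t, sin t) = cis t) by reflexivity.
  rewrite !E1; split; [|split].
  - replace (2 * PI * (IZR k1 * (x + 1) + IZR k2 * y))
      with (2 * PI * (IZR k1 * x + IZR k2 * y + IZR k1)) by ring.
    now rewrite cis_2PI_period.
  - replace (2 * PI * (IZR k1 * x + IZR k2 * (y + 1)))
      with (2 * PI * (IZR k1 * x + IZR k2 * y + IZR k2)) by ring.
    now rewrite cis_2PI_period.
  - assert (H := cis_freq_period k3 z).
    now rewrite (f_equal Re H : cos _ = cos _), (f_equal Im H : sin _ = sin _).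
Qed.

Lemma trig_mode_cont3 k A B : cont3 (trig_mode k A B).
Proof.
  destruct k as [[k1 k2] k3].
  assert (H : cont3 (fun x y _ => horizontal_mode k1 k2 x y)).
  { apply (contC_cis (fun p : R * R * R => 2 * PI * (IZR k1 * fst (fst p) + IZR k2 * snd (fst p)))).
    intros [[x y] z].
    apply (continuous_comp fst (fun p : R * R => 2 * PI * (IZR k1 * fst p + IZR k2 * snd p)));
      [apply continuous_fst|].
    apply (continuous_scal_r (V := R_NormedModule)).
    apply (continuous_plus (fun p : R * R => IZR k1 * fst p) (fun p : R * R => IZR k2 * snd p));
      apply (continuous_scal_r (V := R_NormedModule)); [apply continuous_fst | apply continuous_snd]. }
  assert (L : forall p : R * R * R, continuous (fun p => 2 * PI * IZR k3 * snd p) p).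
  { intros [p z]; apply (continuous_scal_r (V := R_NormedModule)), continuous_snd. }
  apply cont3_plus; apply (contC_mult (fun _ => _)); try apply contC_const.
  - apply (contC_mult _ (fun p : R * R * R => RtoC (cos (2 * PI * IZR k3 * snd p))) H).
    apply contC_RtoC; intros p; apply (continuous_comp (fun p : R * R * R => 2 * PI * IZR k3 * snd p) cos);
      [apply L | apply continuity_pt_filterlim, continuity_cos].
  - apply (contC_mult _ (fun p : R * R * R => RtoC (sin (2 * PI * IZR k3 * snd p))) H).
    apply contC_RtoC; intros p; apply (continuous_comp (fun p : R * R * R => 2 * PI * IZR k3 * snd p) sin);
      [apply L | apply continuity_pt_filterlim, continuity_sin].
Qed.

(** With [dsin], the action of a partial derivative on the coefficient pair of [trig_mode]. *)
Definition dcos (i : axis) (k : wave_number) (A B : C) : C :=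
  let '(k1, k2, k3) := k in
  match i with
  | axis_x => Cmult (imag (freq k1)) A
  | axis_y => Cmult (imag (freq k2)) A
  | axis_z => Cmult (RtoC (freq k3)) B
  end.

Definition dsin (i : axis) (k : wave_number) (A B : C) : C :=
  let '(k1, k2, k3) := k in
  match i with
  | axis_x => Cmult (imag (freq k1)) B
  | axis_y => Cmult (imag (freq k2)) B
  | axis_z => Copp (Cmult (RtoC (freq k3)) A)
  end.

Lemma trig_mode_derive i k A B x y z :
  is_cderive (line i (trig_mode k A B) x y z) (coordinate i x y z)
    (trig_mode k (dcos i k A B) (dsin i k A B) x y z).
Proof.
  destruct k as [[k1 k2] k3], A as [A1 A2], B as [B1 B2].
  destruct i; split; unfold line, coordinate, trig_mode, dcos, dsin, sadd, sscal, cos_mode, sin_mode,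
    horizontal_mode, imag, freq, Ci, RtoC, Copp, Cmult, Cplus, Re, Im, fst, snd;
  auto_derive; auto; ring.
Qed.

Lemma trig_mode_partial i k A B :
  partial i (trig_mode k A B) = trig_mode k (dcos i k A B) (dsin i k A B).
Proof.
  do 3 (apply functional_extensionality; intro).
  apply is_cderive_CDerive, trig_mode_derive.
Qed.

Lemma trig_mode_C1_periodic k A B : C1_periodic (trig_mode k A B).
Proof.
  split; [apply trig_mode_periodic|split; [apply trig_mode_cont3|]].
  intros i; rewrite trig_mode_partial; split; [apply trig_mode_cont3|].
  intros; apply trig_mode_derive.
Qed.

(** Writing [f] as its real part times 1 plus its imaginary part times i reduces differentiability
    in the normed module to two scalar derivatives. *)
Lemma is_cderive_ex (f : R -> C) t l : is_cderive f t l -> @ex_derive R_AbsRing C_R_NormedModule f t.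
Proof.
  intros [H1 H2].
  exists (@plus C_R_NormedModule (@scal _ C_R_NormedModule (Re l) (1, 0))
                                 (@scal _ C_R_NormedModule (Im l) (0, 1))).
  apply (is_derive_ext (fun s => @plus C_R_NormedModule (@scal _ C_R_NormedModule (Re (f s)) (1, 0))
                                 (@scal _ C_R_NormedModule (Im (f s)) (0, 1)))).
  - intros s; destruct (f s) as [p q].
    unfold plus, scal; simpl; unfold prod_plus, prod_scal, scal, plus; simpl; unfold mult; simpl.
    f_equal; ring.
  - apply @is_derive_plus; apply @is_derive_scal_l; assumption.
Qed.

Lemma trig_mode_iter_partial l k : forall A B, exists A' B',
  iter_partial l (trig_mode k A B) = trig_mode k A' B'.
Proof.
  intros A B; induction l as [|i l [A' [B' IH]]]; simpl; [now exists A, B|].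
  rewrite IH, trig_mode_partial; eauto.
Qed.

Lemma trig_mode_smooth k A B : smooth (trig_mode k A B).
Proof.
  intros l x y z; destruct (trig_mode_iter_partial l k A B) as [A' [B' ->]]; split.
  - apply (trig_mode_cont3 k A' B' ((x, y), z)).
  - intros i; apply (is_cderive_ex _ _ _ (trig_mode_derive i k A' B' x y z)).
Qed.

Ltac scalar_ext := do 3 (apply functional_extensionality; intro).

Lemma cos_mode_trig k A : sscal A (cos_mode k) = trig_mode k A (RtoC 0).
Proof. scalar_ext; unfold trig_mode, sadd, sscal; ring. Qed.

Lemma sin_mode_trig k B : sscal B (sin_mode k) = trig_mode k (RtoC 0) B.
Proof. scalar_ext; unfold trig_mode, sadd, sscal; ring. Qed.

Definition mode_field (k : wave_number) (a b c d e : C) : field :=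
  Field (sscal a (cos_mode k)) (sscal b (sin_mode k)) (sscal c (cos_mode k))
        (sscal d (cos_mode k)) (sscal e (sin_mode k)).

Lemma cos_mode_even k A : even_z (sscal A (cos_mode k)).
Proof.
  destruct k as [[k1 k2] k3]; intros x y z; unfold sscal, cos_mode.
  now rewrite <- Ropp_mult_distr_r, cos_neg.
Qed.

Lemma sin_mode_odd k A : odd_z (sscal A (sin_mode k)).
Proof.
  destruct k as [[k1 k2] k3]; intros x y z; unfold sscal, sin_mode.
  rewrite <- Ropp_mult_distr_r, sin_neg, RtoC_opp; ring.
Qed.

Lemma mode_field_admissible k a b c d e : admissible (mode_field k a b c d e).
Proof.
  unfold admissible, on_components, mode_field; simpl.
  repeat split; try apply cos_mode_even; try apply sin_mode_odd;
    rewrite ?cos_mode_trig, ?sin_mode_trig;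
    first [apply trig_mode_periodic | apply trig_mode_smooth].
Qed.

(** * Completeness of the modes on the torus *)

(** Fourier coefficient in the horizontal variables only. The vertical variable is kept free because
    parity has to be used there. *)
Definition horizontal_coef (f : scalar) (k1 k2 : Z) (z : R) : C :=
  cint (fun y => Cmult (cis (2 * PI * IZR k2 * y))
                   (cint (fun x => Cmult (f x y z) (cis (2 * PI * IZR k1 * x))))).

Lemma cont3_cis_x f k1 : cont3 f -> cont3 (fun x y z => Cmult (f x y z) (cis (2 * PI * IZR k1 * x))).
Proof.
  intros Hf; apply contC_mult; auto.
  apply (contC_comp (fun p : R * R * R => fst (fst p)) (fun x => cis (2 * PI * IZR k1 * x)));
    [|apply contC_cis_linear].
  intros [[x y] z]; apply (continuous_comp fst fst); apply continuous_fst.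
Qed.

Lemma cont_horizontal_coef_integrand f k1 k2 : cont3 f ->
  contC (fun p : R * R => Cmult (cis (2 * PI * IZR k2 * fst p))
    (cint (fun x => Cmult (f x (fst p) (snd p)) (cis (2 * PI * IZR k1 * x))))).
Proof.
  intros Hf; apply contC_mult; [|apply (cont3_int_x _ (cont3_cis_x f k1 Hf))].
  apply (contC_comp (fun p : R * R => fst p) (fun x => cis (2 * PI * IZR k2 * x)));
    [|apply contC_cis_linear].
  intros [x y]; apply continuous_fst.
Qed.

Lemma horizontal_coef_cont f k1 k2 : cont3 f -> contC (horizontal_coef f k1 k2).
Proof.
  intros Hf.
  apply (cint_param_continuous (fun y z => Cmult (cis (2 * PI * IZR k2 * y))
    (cint (fun x => Cmult (f x y z) (cis (2 * PI * IZR k1 * x)))))).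
  now apply cont_horizontal_coef_integrand.
Qed.

(** The order of integration is the same on both sides: each factor of the mode leaves the integrals
    over variables on which it does not depend, so no exchange of integrals occurs. *)
Lemma torus_int_horizontal f k1 k2 (w : R -> C) : cont3 f ->
  torus_int (fun x y z => Cmult (f x y z) (Cmult (horizontal_mode k1 k2 x y) (w z))) =
  cint (fun z => Cmult (w z) (horizontal_coef f k1 k2 z)).
Proof.
  intros Hf; unfold torus_int; apply cint_ext; intros z.
  unfold horizontal_coef; rewrite <- cint_scal.
  2:{ apply (contC_left (fun y z => Cmult (cis (2 * PI * IZR k2 * y))
        (cint (fun x => Cmult (f x y z) (cis (2 * PI * IZR k1 * x)))))).
      now apply cont_horizontal_coef_integrand. }
  apply cint_ext; intros y.
  rewrite <- !cint_scal.
  2: { apply contC_mult; [apply contC_const| apply (cont3_x _ y z (cont3_cis_x f k1 Hf))]. }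
  2: apply (cont3_x _ y z (cont3_cis_x f k1 Hf)).
  apply cint_ext; intros x.
  change (horizontal_mode k1 k2 x y) with (cis (2 * PI * (IZR k1 * x + IZR k2 * y))).
  replace (2 * PI * (IZR k1 * x + IZR k2 * y))
    with (2 * PI * IZR k1 * x + 2 * PI * IZR k2 * y) by ring.
  rewrite cis_plus; ring.
Qed.

(** One-variable uniqueness applied twice: in x to [f], then in y to each coefficient in x. *)
Lemma horizontal_coef_zero f : periodic f -> cont3 f ->
  (forall k1 k2 z, horizontal_coef f k1 k2 z = RtoC 0) -> forall x y z, f x y z = RtoC 0.
Proof.
  intros Hp Hf H x y z; revert x.
  apply (fourier_uniqueness (fun x => f x y z)).
  - now apply cont3_x.
  - intros; apply Hp.
  - intros k1; revert y.
    apply (fourier_uniqueness (fun y => cint (fun x => Cmult (f x y z) (cis (2 * PI * IZR k1 * x))))).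
    + apply (contC_left (fun y z => cint (fun x => Cmult (f x y z) (cis (2 * PI * IZR k1 * x))))).
      apply (cont3_int_x _ (cont3_cis_x f k1 Hf)).
    + intros y; apply cint_ext; intros x. now rewrite (proj1 (proj2 (Hp x y z))).
    + intros k2; rewrite <- (H k1 k2 z). apply cint_ext; intros; ring.
Qed.

(** By periodicity, the reflection of z about 0 becomes [x -> 1 - x] on [0, 1]; this substitution
    gives the integral its own opposite. *)
Lemma RInt_reflect_odd (g : R -> R) : (forall x, continuous g x) -> (forall x, g (1 - x) = - g x) ->
  RInt g 0 1 = 0.
Proof.
  intros Hc H.
  assert (E := RInt_comp_lin g (-1) 1 0 1).
  replace (-1 * 0 + 1) with 1 in E by ring. replace (-1 * 1 + 1) with 0 in E by ring.
  specialize (E (ex_RInt_cont g _ _ Hc)).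
  rewrite (RInt_ext _ g) in E.
  - rewrite <- (opp_RInt_swap g 0 1) in E by now apply ex_RInt_cont.
    change (RInt g 0 1 = - RInt g 0 1) in E. lra.
  - intros x _. replace (-1 * x + 1) with (1 - x) by ring. rewrite H.
    change (-1 * - g x = g x); ring.
Qed.

Lemma cint_reflect_odd (g : R -> C) : contC g -> (forall x, g (1 - x) = Copp (g x)) -> cint g = RtoC 0.
Proof.
  intros Hc H; unfold cint, RtoC; f_equal; apply RInt_reflect_odd; intros;
    try (now apply contC_Re); try (now apply contC_Im); now rewrite H.
Qed.

(** Here [g] is a horizontal coefficient, [p] the vertical profile of the same parity, whose
    coefficient is assumed to vanish, and [q] the profile of opposite parity, killed by
    reflection. *)
Lemma even_odd_coef_zero (g p q : R -> C) : contC g -> contC p -> contC q ->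
  cint (fun z => Cmult (p z) (g z)) = RtoC 0 ->
  (forall z, Cmult (q (1 - z)) (g (1 - z)) = Copp (Cmult (q z) (g z))) ->
  forall c d, cint (fun z => Cmult (g z) (Cplus (Cmult c (p z)) (Cmult d (q z)))) = RtoC 0.
Proof.
  intros Hg Hp Hq H Ho c d.
  assert (O := cint_reflect_odd (fun z => Cmult (q z) (g z)) (contC_mult _ _ Hq Hg) Ho).
  rewrite (cint_ext _ (fun z => Cplus (Cmult c (Cmult (p z) (g z))) (Cmult d (Cmult (q z) (g z)))))
    by (intros; ring).
  rewrite cint_plus, !cint_scal, H, O by auto using (@contC_mult R_UniformSpace), (@contC_const R_UniformSpace).
  ring.
Qed.

Lemma contC_cos_freq k : contC (fun z => RtoC (cos (2 * PI * IZR k * z))).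
Proof.
  apply contC_RtoC; intros; apply (contC_Re (fun z => cis (2 * PI * IZR k * z))), contC_cis_linear.
Qed.

Lemma contC_sin_freq k : contC (fun z => RtoC (sin (2 * PI * IZR k * z))).
Proof.
  apply contC_RtoC; intros; apply (contC_Im (fun z => cis (2 * PI * IZR k * z))), contC_cis_linear.
Qed.

Lemma cis_decomp t : cis t = Cplus (Cmult (RtoC 1) (RtoC (cos t))) (Cmult Ci (RtoC (sin t))).
Proof. unfold cis, Cplus, Cmult, RtoC, Ci; simpl; f_equal; ring. Qed.

Lemma cis_freq_reflect (n : Z) (z : R) :
  cis (2 * PI * IZR n * (1 - z)) = cis (- (2 * PI * IZR n * z)).
Proof.
  replace (1 - z) with (- z + 1) by ring; rewrite cis_freq_period; f_equal; ring.
Qed.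

(** The factor [s] is 1 for even and -1 for odd functions, so both parities share one proof. *)
Lemma horizontal_coef_reflect f k1 k2 z (s : C) : periodic f -> cont3 f ->
  (forall x y z, f x y (- z) = Cmult s (f x y z)) ->
  horizontal_coef f k1 k2 (1 - z) = Cmult s (horizontal_coef f k1 k2 z).
Proof.
  intros Hp Hf H; unfold horizontal_coef.
  rewrite <- cint_scal.
  2:{ apply (contC_left (fun y z => Cmult (cis (2 * PI * IZR k2 * y))
        (cint (fun x => Cmult (f x y z) (cis (2 * PI * IZR k1 * x)))))).
      now apply cont_horizontal_coef_integrand. }
  apply cint_ext; intros y.
  rewrite (cint_ext _ (fun x => Cmult s (Cmult (f x y z) (cis (2 * PI * IZR k1 * x))))).
  - rewrite cint_scal; [ring|]. apply (cont3_x _ y z (cont3_cis_x f k1 Hf)).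
  - intros x. replace (1 - z) with (- z + 1) by ring.
    rewrite (proj2 (proj2 (Hp x y (- z)))), H; ring.
Qed.

Lemma horizontal_coef_periodic f k1 k2 z : periodic f ->
  horizontal_coef f k1 k2 (z + 1) = horizontal_coef f k1 k2 z.
Proof.
  intros Hp; unfold horizontal_coef; apply cint_ext; intros y; f_equal.
  apply cint_ext; intros x. now rewrite (proj2 (proj2 (Hp x y z))).
Qed.

(** Uniqueness in z asks for the coefficient of each exponential. Its cosine part is the hypothesis
    and its sine part vanishes by parity. *)
Lemma even_completeness f : periodic f -> cont3 f -> even_z f ->
  (forall k, torus_int (smul f (cos_mode k)) = RtoC 0) -> forall x y z, f x y z = RtoC 0.
Proof.
  intros Hp Hf He H; apply horizontal_coef_zero; auto; intros k1 k2.
  apply fourier_uniqueness; [now apply horizontal_coef_cont | intros; now apply horizontal_coef_periodic|].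
  intros k.
  rewrite (cint_ext _ (fun z => Cmult (horizontal_coef f k1 k2 z)
     (Cplus (Cmult (RtoC 1) (RtoC (cos (2 * PI * IZR k * z))))
            (Cmult Ci (RtoC (sin (2 * PI * IZR k * z)))))))
    by (intros; now rewrite cis_decomp).
  apply (even_odd_coef_zero _ (fun z => RtoC (cos (2 * PI * IZR k * z)))
           (fun z => RtoC (sin (2 * PI * IZR k * z))));
    auto using contC_cos_freq, contC_sin_freq, horizontal_coef_cont.
  - rewrite <- (torus_int_horizontal f k1 k2) by auto. apply (H (k1, k2, k)).
  - intros z. rewrite (f_equal Im (cis_freq_reflect k z) : sin _ = sin _), sin_neg.
    rewrite (horizontal_coef_reflect f k1 k2 z (RtoC 1)); auto.
    + rewrite RtoC_opp; ring.
    + intros; rewrite He; ring.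
Qed.

Lemma odd_completeness f : periodic f -> cont3 f -> odd_z f ->
  (forall k, torus_int (smul f (sin_mode k)) = RtoC 0) -> forall x y z, f x y z = RtoC 0.
Proof.
  intros Hp Hf He H; apply horizontal_coef_zero; auto; intros k1 k2.
  apply fourier_uniqueness; [now apply horizontal_coef_cont | intros; now apply horizontal_coef_periodic|].
  intros k.
  rewrite (cint_ext _ (fun z => Cmult (horizontal_coef f k1 k2 z)
     (Cplus (Cmult Ci (RtoC (sin (2 * PI * IZR k * z))))
            (Cmult (RtoC 1) (RtoC (cos (2 * PI * IZR k * z)))))))
    by (intros; rewrite cis_decomp; ring).
  apply (even_odd_coef_zero _ (fun z => RtoC (sin (2 * PI * IZR k * z)))
           (fun z => RtoC (cos (2 * PI * IZR k * z))));
    auto using contC_cos_freq, contC_sin_freq, horizontal_coef_cont.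
  - rewrite <- (torus_int_horizontal f k1 k2) by auto. apply (H (k1, k2, k)).
  - intros z. rewrite (f_equal Re (cis_freq_reflect k z) : cos _ = cos _), cos_neg.
    rewrite (horizontal_coef_reflect f k1 k2 z (Copp (RtoC 1))); auto.
    + ring.
    + intros; rewrite He; ring.
Qed.

(** * Reduction to a single wave number *)

(** The eigenvalue equation of [lin_comb al be] on the amplitudes [a], [b], [c], [d], [e] of the
    components q, H, v1, v2, w. *)
Definition mode_system (al be : R) (k : wave_number) (l a b c d e : C) : Prop :=
  let '(k1, k2, k3) := k in
  Cmult l a = Cmult (RtoC al) (Cplus (Cplus (Cmult (imag (freq k1)) c) (Cmult (imag (freq k2)) d))
                                 (Cmult (RtoC (freq k3)) e)) /\
  Cmult l b = Copp (Cmult (RtoC be) e) /\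
  Cmult l c = Cmult (RtoC al) (Cmult (imag (freq k1)) a) /\
  Cmult l d = Cmult (RtoC al) (Cmult (imag (freq k2)) a) /\
  Cmult l e = Cplus (Copp (Cmult (RtoC al) (Cmult (RtoC (freq k3)) a))) (Cmult (RtoC be) b).

Definition vertical (k : wave_number) : Z := let '(_, _, k3) := k in k3.

(* When the vertical wave number vanishes the sine modes are zero, so their coefficients are
   normalised to 0. *)
Definition mode_eigenvalue (al be : R) (k : wave_number) (l : C) : Prop :=
  exists a b c d e : C,
    ~ (a = 0 /\ b = 0 /\ c = 0 /\ d = 0 /\ e = 0)%C /\
    (vertical k = 0%Z -> b = RtoC 0 /\ e = RtoC 0) /\
    mode_system al be k l a b c d e.

Lemma scalar_eq (f g : scalar) : (forall x y z, f x y z = g x y z) -> f = g.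
Proof. intros H; scalar_ext; apply H. Qed.

Lemma feq_eq (U V : field) : feq U V -> U = V.
Proof.
  destruct U, V; intros H; unfold feq in H; simpl in H.
  f_equal; apply scalar_eq; intros x y z; apply (H x y z).
Qed.

Lemma cos_mode_0 k : cos_mode k 0 0 0 = RtoC 1.
Proof.
  destruct k as [[k1 k2] k3]; unfold cos_mode, horizontal_mode, Cmult, RtoC; simpl.
  rewrite !Rmult_0_r, Rplus_0_r, Rmult_0_r, cos_0, sin_0; f_equal; ring.
Qed.

Lemma sin_mode_1 k : vertical k <> 0%Z -> sin_mode k 0 0 (/ (4 * IZR (vertical k))) = RtoC 1.
Proof.
  destruct k as [[k1 k2] k3]; unfold sin_mode, horizontal_mode, Cmult, RtoC; simpl; intros H.
  apply eq_IZR_contrapositive in H.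
  replace (2 * PI * IZR k3 * / (4 * IZR k3)) with (PI / 2) by (field; auto).
  rewrite !Rmult_0_r, Rplus_0_r, Rmult_0_r, cos_0, sin_0, sin_PI2; f_equal; ring.
Qed.

Lemma sin_mode_vertical_0 k x y z : vertical k = 0%Z -> sin_mode k x y z = RtoC 0.
Proof.
  destruct k as [[k1 k2] k3]; unfold sin_mode; simpl; intros ->.
  rewrite Rmult_0_r, Rmult_0_l, sin_0; ring.
Qed.

(** Coefficients are recovered by evaluation where the mode equals 1: the origin for cosines, a
    quarter of a vertical period for sines. *)
Lemma mode_field_inj k a b c d e a' b' c' d' e' :
  mode_field k a b c d e = mode_field k a' b' c' d' e' ->
  a = a' /\ c = c' /\ d = d' /\ (vertical k <> 0%Z -> b = b' /\ e = e').
Proof.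
  intros H; injection H as Ha Hb Hc Hd He.
  assert (Ic : forall A B, sscal A (cos_mode k) = sscal B (cos_mode k) -> A = B).
  { intros A B E. assert (E0 := f_equal (fun f : scalar => f 0 0 0) E); simpl in E0.
    unfold sscal in E0; rewrite cos_mode_0, !Cmult_1_r in E0; auto. }
  assert (Is : vertical k <> 0%Z ->
             forall A B, sscal A (sin_mode k) = sscal B (sin_mode k) -> A = B).
  { intros Hk A B E.
    assert (E0 := f_equal (fun f : scalar => f 0 0 (/ (4 * IZR (vertical k)))) E); simpl in E0.
    unfold sscal in E0; rewrite sin_mode_1, !Cmult_1_r in E0; auto. }
  repeat split; auto.
Qed.

Lemma mode_field_eq k a b c d e a' b' c' d' e' :
  a = a' -> c = c' -> d = d' -> (vertical k <> 0%Z -> b = b' /\ e = e') ->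
  mode_field k a b c d e = mode_field k a' b' c' d' e'.
Proof.
  intros -> -> -> H; destruct (Z.eq_dec (vertical k) 0) as [E|E].
  - unfold mode_field; f_equal; apply scalar_eq; intros; unfold sscal;
      rewrite sin_mode_vertical_0 by auto; ring.
  - now destruct (H E) as [-> ->].
Qed.

Lemma fscal_mode_field l k a b c d e : fscal l (mode_field k a b c d e) =
  mode_field k (Cmult l a) (Cmult l b) (Cmult l c) (Cmult l d) (Cmult l e).
Proof.
  unfold fscal, mode_field; simpl; f_equal; apply scalar_eq; intros; unfold sscal; ring.
Qed.

Lemma lin_comb_mode_field al be k1 k2 k3 a b c d e :
  lin_comb al be (mode_field (k1, k2, k3) a b c d e) =
  mode_field (k1, k2, k3)
    (Cmult (RtoC al) (Cplus (Cplus (Cmult (imag (freq k1)) c) (Cmult (imag (freq k2)) d))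
                                 (Cmult (RtoC (freq k3)) e)))
    (Copp (Cmult (RtoC be) e))
    (Cmult (RtoC al) (Cmult (imag (freq k1)) a))
    (Cmult (RtoC al) (Cmult (imag (freq k2)) a))
    (Cplus (Copp (Cmult (RtoC al) (Cmult (RtoC (freq k3)) a))) (Cmult (RtoC be) b)).
Proof.
  unfold lin_comb, La, Lg, fadd, fscal, mode_field; simpl.
  rewrite !cos_mode_trig, !sin_mode_trig, !trig_mode_partial; simpl.
  f_equal; apply scalar_eq; intros; unfold trig_mode, sadd, sscal, szero; ring.
Qed.

Lemma eigenvalue_at_iff al be k l :
  eigenvalue_at k (lin_comb al be) l <-> mode_eigenvalue al be k l.
Proof.
  split.
  - intros [U [[_ [a [b [c [d [e HU]]]]]] [Hn He]]].
    apply feq_eq in HU; apply feq_eq in He; subst U.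
    fold (mode_field k a b c d e) in *.
    (* Replacing the sine coefficients by 0 when [k3 = 0] leaves the field unchanged and reaches the
       normalised form. *)
    set (n := fun t : C => if Z.eq_dec (vertical k) 0 then RtoC 0 else t).
    assert (E : mode_field k a b c d e = mode_field k a (n b) c d (n e)).
    { apply mode_field_eq; auto; intros H; unfold n; destruct Z.eq_dec; tauto. }
    assert (N : vertical k = 0%Z -> n b = RtoC 0 /\ n e = RtoC 0)
      by (intros H; unfold n; destruct Z.eq_dec; tauto).
    rewrite E in Hn, He; clear E; generalize dependent (n b); generalize dependent (n e).
    clear n b e; intros e b He Hn N.
    exists a, b, c, d, e; split; [|split; auto].
    + intros (-> & -> & -> & -> & ->); apply Hn.
      intros x y z; unfold mode_field, fzero, szero, sscal; simpl.
      repeat split; ring.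
    + destruct k as [[k1 k2] k3].
      rewrite lin_comb_mode_field, fscal_mode_field in He.
      destruct (mode_field_inj _ _ _ _ _ _ _ _ _ _ _ He) as (E1 & E2 & E3 & H).
      simpl in *; rewrite <- E1, <- E2, <- E3; destruct (Z.eq_dec k3 0) as [Z|Z].
      (* With [k3 = 0] the sine components of the field equation carry no information, but their two
         scalar equations reduce to 0 = 0. *)
      * destruct (N Z) as [-> ->]; rewrite Z; unfold freq; rewrite Rmult_0_r.
        repeat split; ring.
      * destruct (H Z) as [E4 E5]; rewrite <- E4, <- E5; auto.
  - intros (a & b & c & d & e & Hn & Hv & Hs).
    exists (mode_field k a b c d e); split; [split; [apply mode_field_admissible|]|split].
    + exists a, b, c, d, e; unfold feq; auto.
    + intros H; apply Hn; apply feq_eq in H.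
      assert (Z : fzero = mode_field k 0 0 0 0 0)
        by (unfold fzero, mode_field; f_equal; apply scalar_eq; intros; unfold szero, sscal; ring).
      rewrite Z in H; apply mode_field_inj in H. destruct H as (-> & -> & -> & H).
      destruct (Z.eq_dec (vertical k) 0); [destruct Hv | destruct H]; auto.
    + assert (E : lin_comb al be (mode_field k a b c d e) = fscal l (mode_field k a b c d e)).
      { destruct k as [[k1 k2] k3]; simpl in Hs.
        destruct Hs as (E1 & E2 & E3 & E4 & E5).
        now rewrite lin_comb_mode_field, fscal_mode_field, E1, E2, E3, E4, E5. }
      rewrite E; unfold feq; auto.
Qed.

(** * Projection of an eigenfunction onto a wave number *)

Lemma torus_int_smul_plus f g p : cont3 f -> cont3 g -> cont3 p ->
  torus_int (smul (sadd f g) p) = Cplus (torus_int (smul f p)) (torus_int (smul g p)).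
Proof.
  intros; rewrite <- torus_int_plus by now apply cont3_mul.
  f_equal; apply scalar_eq; intros; unfold smul, sadd; ring.
Qed.

Lemma torus_int_smul_scal c f p : cont3 f -> cont3 p ->
  torus_int (smul (sscal c f) p) = Cmult c (torus_int (smul f p)).
Proof.
  intros; rewrite <- torus_int_scal by now apply cont3_mul.
  f_equal; apply scalar_eq; intros; unfold smul, sscal; ring.
Qed.

(* Conjugating a mode reverses only its horizontal wave numbers. *)
Definition dual (k : wave_number) : wave_number := let '(k1, k2, k3) := k in (- k1, - k2, k3)%Z.

(** No normalising factor: these integrals satisfy the mode equations exactly as they stand, and
    otherwise only their vanishing matters. *)
Definition cos_coef (f : scalar) (k : wave_number) : C := torus_int (smul f (cos_mode (dual k))).
Definition sin_coef (f : scalar) (k : wave_number) : C := torus_int (smul f (sin_mode (dual k))).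

Lemma cos_mode_trig1 k : cos_mode k = trig_mode k 1 0.
Proof. apply scalar_eq; intros; unfold trig_mode, sadd, sscal; ring. Qed.

Lemma sin_mode_trig1 k : sin_mode k = trig_mode k 0 1.
Proof. apply scalar_eq; intros; unfold trig_mode, sadd, sscal; ring. Qed.

Lemma cont3_cos_mode k : cont3 (cos_mode k).
Proof. rewrite cos_mode_trig1; apply trig_mode_cont3. Qed.

Lemma cont3_sin_mode k : cont3 (sin_mode k).
Proof. rewrite sin_mode_trig1; apply trig_mode_cont3. Qed.

Lemma cont3_scal c f : cont3 f -> cont3 (sscal c f).
Proof. intros; apply contC_mult; auto; apply contC_const. Qed.

Lemma coef_partial i f k A B : C1_periodic f ->
  torus_int (smul (partial i f) (trig_mode (dual k) A B)) =
  Copp (Cplus (Cmult (dcos i (dual k) A B) (cos_coef f k)) (Cmult (dsin i (dual k) A B) (sin_coef f k))).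
Proof.
  intros Hf; rewrite integration_by_parts by auto using trig_mode_C1_periodic.
  rewrite trig_mode_partial; f_equal; unfold cos_coef, sin_coef.
  assert (Cf := C1_periodic_cont3 f Hf).
  rewrite <- !torus_int_scal by auto using cont3_mul, cont3_cos_mode, cont3_sin_mode.
  rewrite <- torus_int_plus by auto using cont3_scal, cont3_mul, cont3_cos_mode, cont3_sin_mode.
  f_equal; apply scalar_eq; intros; unfold trig_mode, smul, sadd, sscal; ring.
Qed.

Lemma imag_freq_opp n : imag (freq (- n)) = Copp (imag (freq n)).
Proof. unfold imag, freq; rewrite opp_IZR, <- Ropp_mult_distr_r, RtoC_opp; ring. Qed.

(** The sign from integration by parts cancels against the reversed horizontal wave number of
    [dual], which leaves the factor that occurs in [mode_system]. *)
Lemma cos_coef_partial_x f k1 k2 k3 : C1_periodic f ->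
  cos_coef (partial axis_x f) (k1, k2, k3) = Cmult (imag (freq k1)) (cos_coef f (k1, k2, k3)).
Proof.
  intros H; unfold cos_coef at 1; rewrite cos_mode_trig1, coef_partial by auto; simpl.
  rewrite imag_freq_opp; ring.
Qed.

Lemma cos_coef_partial_y f k1 k2 k3 : C1_periodic f ->
  cos_coef (partial axis_y f) (k1, k2, k3) = Cmult (imag (freq k2)) (cos_coef f (k1, k2, k3)).
Proof.
  intros H; unfold cos_coef at 1; rewrite cos_mode_trig1, coef_partial by auto; simpl.
  rewrite imag_freq_opp; ring.
Qed.

Lemma cos_coef_partial_z f k1 k2 k3 : C1_periodic f ->
  cos_coef (partial axis_z f) (k1, k2, k3) = Cmult (RtoC (freq k3)) (sin_coef f (k1, k2, k3)).
Proof.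
  intros H; unfold cos_coef at 1; rewrite cos_mode_trig1, coef_partial by auto; simpl; ring.
Qed.

Lemma sin_coef_partial_z f k1 k2 k3 : C1_periodic f ->
  sin_coef (partial axis_z f) (k1, k2, k3) = Copp (Cmult (RtoC (freq k3)) (cos_coef f (k1, k2, k3))).
Proof.
  intros H; unfold sin_coef at 1; rewrite sin_mode_trig1, coef_partial by auto; simpl; ring.
Qed.

Lemma cos_coef_plus f g k : cont3 f -> cont3 g ->
  cos_coef (sadd f g) k = Cplus (cos_coef f k) (cos_coef g k).
Proof. intros; now apply torus_int_smul_plus; auto using cont3_cos_mode. Qed.

Lemma sin_coef_plus f g k : cont3 f -> cont3 g ->
  sin_coef (sadd f g) k = Cplus (sin_coef f k) (sin_coef g k).
Proof. intros; now apply torus_int_smul_plus; auto using cont3_sin_mode. Qed.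

Lemma cos_coef_scal c f k : cont3 f -> cos_coef (sscal c f) k = Cmult c (cos_coef f k).
Proof. intros; now apply torus_int_smul_scal; auto using cont3_cos_mode. Qed.

Lemma sin_coef_scal c f k : cont3 f -> sin_coef (sscal c f) k = Cmult c (sin_coef f k).
Proof. intros; now apply torus_int_smul_scal; auto using cont3_sin_mode. Qed.

Lemma dualK k : dual (dual k) = k.
Proof. destruct k as [[k1 k2] k3]; simpl; now rewrite !Z.opp_involutive. Qed.

Lemma cos_coef_complete f : periodic f -> cont3 f -> even_z f ->
  (forall k, cos_coef f k = RtoC 0) -> f = szero.
Proof.
  intros Hp Hc He H; apply scalar_eq; refine (even_completeness f Hp Hc He _).
  intros k; rewrite <- (dualK k); apply H.
Qed.

Lemma sin_coef_complete f : periodic f -> cont3 f -> odd_z f ->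
  (forall k, sin_coef f k = RtoC 0) -> f = szero.
Proof.
  intros Hp Hc He H; apply scalar_eq; refine (odd_completeness f Hp Hc He _).
  intros k; rewrite <- (dualK k); apply H.
Qed.

Lemma sin_coef_vertical_0 f k : vertical k = 0%Z -> sin_coef f k = RtoC 0.
Proof.
  intros H; unfold sin_coef; rewrite <- torus_int_0; f_equal.
  apply scalar_eq; intros; unfold smul, szero.
  rewrite sin_mode_vertical_0; [ring|]. destruct k as [[k1 k2] k3]; auto.
Qed.

(* The projection of an eigenfunction onto a wave number is an eigenfunction or zero, and by
   completeness some projection is nonzero. *)
Lemma eigenvalue_mode al be l : eigenvalue (lin_comb al be) l ->
  exists k, mode_eigenvalue al be k l.
Proof.
  intros [U [[(Pq & PH & P1 & P2 & Pw)
    [(Sq & SH & S1 & S2 & Sw) (Eq & EH & E1 & E2 & Ew)]] [Hn He]]].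
  apply feq_eq in He; destruct U as [q H v1 v2 w]; simpl in *.
  assert (Cq := smooth_C1_periodic _ Pq Sq). assert (CH := smooth_C1_periodic _ PH SH).
  assert (C1 := smooth_C1_periodic _ P1 S1). assert (C2 := smooth_C1_periodic _ P2 S2).
  assert (Cw := smooth_C1_periodic _ Pw Sw).
  assert (cq := C1_periodic_cont3 q Cq). assert (cH := C1_periodic_cont3 H CH).
  assert (c1 := C1_periodic_cont3 v1 C1). assert (c2 := C1_periodic_cont3 v2 C2).
  assert (cw := C1_periodic_cont3 w Cw).
  assert (D : forall i f, C1_periodic f -> cont3 (partial i f)) by (intros i f Hf; exact (proj1 (proj2 (proj2 Hf) i))).
  assert (c0 : cont3 szero) by exact (contC_const (RtoC 0)).
  apply NNPP; intros N; apply Hn.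
  (* If some coefficient at [k] were nonzero, the five of them would solve [mode_system]
     nontrivially, against [N]. *)
  assert (A : forall k, (cos_coef q k = 0 /\ sin_coef H k = 0 /\ cos_coef v1 k = 0 /\
                         cos_coef v2 k = 0 /\ sin_coef w k = 0)%C).
  { intros k; apply NNPP; intros M; apply N; exists k.
    exists (cos_coef q k), (sin_coef H k), (cos_coef v1 k), (cos_coef v2 k), (sin_coef w k).
    split; [auto|split; [auto using sin_coef_vertical_0|]].
    unfold lin_comb, fadd, fscal, La, Lg in He; simpl in He.
    injection He as e1 e2 e3 e4 e5.
    assert (Z : forall f, cos_coef (sscal f szero) k = RtoC 0).
    { intros f; rewrite cos_coef_scal by auto. unfold cos_coef.
      replace (smul szero (cos_mode (dual k))) with szero; [rewrite torus_int_0; ring|].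
      apply scalar_eq; intros; unfold smul, szero; ring. }
    assert (Z' : forall f, sin_coef (sscal f szero) k = RtoC 0).
    { intros f; rewrite sin_coef_scal by auto. unfold sin_coef.
      replace (smul szero (sin_mode (dual k))) with szero; [rewrite torus_int_0; ring|].
      apply scalar_eq; intros; unfold smul, szero; ring. }
    apply (f_equal (fun f => cos_coef f k)) in e1, e3, e4.
    apply (f_equal (fun f => sin_coef f k)) in e2, e5.
    destruct k as [[k1 k2] k3]; simpl.
    rewrite cos_coef_plus, Z, !cos_coef_scal, !cos_coef_plus, cos_coef_partial_x, cos_coef_partial_y,
      cos_coef_partial_z in e1 by auto 8 using cont3_scal, cont3_plus.
    rewrite cos_coef_plus, Z, !cos_coef_scal, cos_coef_partial_x in e3
      by auto 8 using cont3_scal, cont3_plus.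
    rewrite cos_coef_plus, Z, !cos_coef_scal, cos_coef_partial_y in e4
      by auto 8 using cont3_scal, cont3_plus.
    rewrite sin_coef_plus, Z', !sin_coef_scal in e2
      by auto 8 using cont3_scal, cont3_plus.
    rewrite sin_coef_plus, !sin_coef_scal, sin_coef_partial_z in e5
      by auto 8 using cont3_scal, cont3_plus.
    rewrite <- e1, <- e2, <- e3, <- e4, <- e5.
    replace (RtoC (-1)) with (Copp (RtoC 1)) by (rewrite <- RtoC_opp; auto).
    repeat split; ring. }
  assert (Zq := cos_coef_complete q Pq cq Eq (fun k => proj1 (A k))).
  assert (ZH := sin_coef_complete H PH cH EH (fun k => proj1 (proj2 (A k)))).
  assert (Z1 := cos_coef_complete v1 P1 c1 E1 (fun k => proj1 (proj2 (proj2 (A k))))).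
  assert (Z2 := cos_coef_complete v2 P2 c2 E2 (fun k => proj1 (proj2 (proj2 (proj2 (A k)))))).
  assert (Zw := sin_coef_complete w Pw cw Ew (fun k => proj2 (proj2 (proj2 (proj2 (A k)))))).
  subst; unfold feq; auto.
Qed.

Lemma mode_eigenvalue_eigenvalue al be k l :
  mode_eigenvalue al be k l -> eigenvalue (lin_comb al be) l.
Proof.
  intros H; apply eigenvalue_at_iff in H.
  destruct H as [U [[HU _] H]]; exists U; auto.
Qed.

(** * Dispersion relation *)

(** This is [|K_h|^2]; [ksq] is [|K|^2], the eigenvalue of minus the Laplacian on the mode, hence a
    squared acoustic frequency. *)
Definition hsq (k : wave_number) : R := let '(k1, k2, _) := k in freq k1 ^ 2 + freq k2 ^ 2.
Definition ksq (k : wave_number) : R := hsq k + freq (vertical k) ^ 2.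

(** By Vieta, [disp_sum] and [disp_prod] are the sum and product of the two values of [w^2];
    [disp_root] is the square root of the discriminant. *)
Definition disp_sum (al be : R) (k : wave_number) : R := al ^ 2 * ksq k + be ^ 2.
Definition disp_prod (al be : R) (k : wave_number) : R := al ^ 2 * be ^ 2 * hsq k.
Definition disp_root (al be : R) (k : wave_number) : R :=
  sqrt (disp_sum al be k ^ 2 - 4 * disp_prod al be k).

Definition gw_sq (al be : R) (k : wave_number) : R :=
  (disp_sum al be k - disp_root al be k) / 2.

(* Fields without vertical dependence have w = 0 and do not feel gravity. *)
Definition aw_sq (al be : R) (k : wave_number) : R :=
  if Z.eq_dec (vertical k) 0 then al ^ 2 * ksq k
  else (disp_sum al be k + disp_root al be k) / 2.

(** If [K_h = 0] the product of the roots vanishes and the smaller root is 0, which is already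
    counted as mean flow. *)
Definition has_gw (k : wave_number) : Prop := vertical k <> 0%Z /\ hsq k <> 0.
Definition has_aw (k : wave_number) : Prop := ksq k <> 0.

Lemma hsq_nonneg k : 0 <= hsq k.
Proof. destruct k as [[k1 k2] k3]; simpl; nra. Qed.

Lemma hsq_le_ksq k : hsq k <= ksq k.
Proof. unfold ksq; nra. Qed.

Lemma ksq_nonneg k : 0 <= ksq k.
Proof. assert (A := hsq_nonneg k); assert (B := hsq_le_ksq k); lra. Qed.

(** The difference of the two sides is [4 al^2 be^2 (ksq k - hsq k)], and [ksq k - hsq k] is the
    square of the vertical frequency. *)
Lemma disp_discr_ge al be k :
  (al ^ 2 * ksq k - be ^ 2) ^ 2 <= disp_sum al be k ^ 2 - 4 * disp_prod al be k.
Proof.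
  unfold disp_sum, disp_prod.
  assert (0 <= al ^ 2 * be ^ 2 * (ksq k - hsq k)).
  { apply Rmult_le_pos; [apply Rmult_le_pos; apply pow2_ge_0 |].
    assert (B := hsq_le_ksq k); lra. }
  nra.
Qed.

Lemma disp_root_sq al be k :
  disp_root al be k * disp_root al be k = disp_sum al be k ^ 2 - 4 * disp_prod al be k.
Proof.
  apply sqrt_sqrt. assert (A := disp_discr_ge al be k).
  assert (B := pow2_ge_0 (al ^ 2 * ksq k - be ^ 2)); lra.
Qed.

Lemma disp_root_ge al be k : Rabs (al ^ 2 * ksq k - be ^ 2) <= disp_root al be k.
Proof.
  rewrite <- sqrt_Rsqr_abs, Rsqr_pow2; apply sqrt_le_1_alt, disp_discr_ge.
Qed.

Lemma disp_prod_nonneg al be k : 0 <= disp_prod al be k.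
Proof.
  apply Rmult_le_pos; [apply Rmult_le_pos; apply pow2_ge_0 | apply hsq_nonneg].
Qed.

Lemma disp_root_le al be k : disp_root al be k <= disp_sum al be k.
Proof.
  assert (A := disp_root_sq al be k). assert (B := disp_prod_nonneg al be k).
  assert (C : 0 <= disp_sum al be k).
  { unfold disp_sum; assert (H := ksq_nonneg k); nra. }
  assert (D := sqrt_pos (disp_sum al be k ^ 2 - 4 * disp_prod al be k)).
  fold (disp_root al be k) in D. nra.
Qed.

(** The root of the discriminant lies between [al^2 |K|^2 - be^2] and [al^2 |K|^2 + be^2]; half the
    sum minus half of either end gives the two bounds. *)
Lemma gw_sq_bounds al be k : 0 <= gw_sq al be k <= be ^ 2.
Proof.
  unfold gw_sq. assert (A := disp_root_le al be k). assert (B := disp_root_ge al be k).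
  apply Rabs_le_between in B. unfold disp_sum in *; lra.
Qed.

Lemma aw_sq_bounds al be k : al ^ 2 * ksq k <= aw_sq al be k <= al ^ 2 * ksq k + be ^ 2.
Proof.
  unfold aw_sq; destruct Z.eq_dec; [assert (0 <= be ^ 2) by apply pow2_ge_0; lra|].
  assert (A := disp_root_le al be k). assert (B := disp_root_ge al be k).
  apply Rabs_le_between in B. unfold disp_sum in *; lra.
Qed.

Lemma aw_sq_nonneg al be k : 0 <= aw_sq al be k.
Proof.
  assert (A := aw_sq_bounds al be k). assert (B := ksq_nonneg k).
  assert (C := pow2_ge_0 al). nra.
Qed.

Lemma gw_aw_sum al be k : vertical k <> 0%Z -> gw_sq al be k + aw_sq al be k = disp_sum al be k.
Proof. intros H; unfold gw_sq, aw_sq; destruct Z.eq_dec; [tauto | lra]. Qed.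

Lemma gw_aw_prod al be k : vertical k <> 0%Z -> gw_sq al be k * aw_sq al be k = disp_prod al be k.
Proof.
  intros H; unfold gw_sq, aw_sq; destruct Z.eq_dec; [tauto |].
  assert (A := disp_root_sq al be k); nra.
Qed.

(** * Spectrum at one wave number *)

Lemma Ci_sq : Cmult Ci Ci = Copp (RtoC 1).
Proof. unfold Cmult, Ci, Copp, RtoC; simpl; f_equal; ring. Qed.

Lemma freq_0 : freq 0 = 0.
Proof. unfold freq; ring. Qed.

Lemma freq_neq_0 n : n <> 0%Z -> freq n <> 0.
Proof.
  intros H; apply eq_IZR_contrapositive in H. assert (P := PI_RGT_0).
  unfold freq; apply Rmult_integral_contrapositive; split; lra.
Qed.

Lemma RtoC_neq (r : R) : r <> 0 -> RtoC r <> RtoC 0.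
Proof. intros H E; now apply H, RtoC_inj. Qed.

Lemma Cmult_zero (x y : C) : Cmult x y = RtoC 0 -> x = RtoC 0 \/ y = RtoC 0.
Proof.
  intros H; destruct (classic (x = RtoC 0)) as [|N]; auto; right.
  replace y with (Cmult (Cinv x) (Cmult x y)) by (field; auto). rewrite H; ring.
Qed.

Lemma Cminus_zero (x y : C) : Cminus x y = RtoC 0 -> x = y.
Proof. intros H; replace x with (Cplus (Cminus x y) y) by ring; rewrite H; ring. Qed.

(** Elimination of the horizontal velocity by multiplying with [l] instead of dividing, so that no
    case distinction arises. For [k3 = 0] this is already the acoustic dispersion relation. *)
Lemma system_horizontal (l al K1 K2 K3 a c d e : C)
  (Ea : Cmult l a = Cmult al (Cplus (Cplus (Cmult (Cmult Ci K1) c) (Cmult (Cmult Ci K2) d))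
                                  (Cmult K3 e)))
  (Ec : Cmult l c = Cmult al (Cmult (Cmult Ci K1) a))
  (Ed : Cmult l d = Cmult al (Cmult (Cmult Ci K2) a)) :
  let H := Cplus (Cmult K1 K1) (Cmult K2 K2) in
  Cmult (Cplus (Cmult l l) (Cmult (Cmult al al) H)) a = Cmult (Cmult al K3) (Cmult l e).
Proof.
  intros H.
  transitivity (Cplus (Cmult l (Cmult l a)) (Cmult (Cmult (Cmult al al) H) a)); [unfold H; ring|].
  rewrite Ea.
  transitivity (Cplus (Cmult al (Cplus (Cplus (Cmult (Cmult Ci K1) (Cmult l c))
     (Cmult (Cmult Ci K2) (Cmult l d))) (Cmult K3 (Cmult l e)))) (Cmult (Cmult (Cmult al al) H) a)).
  { ring. }
  rewrite Ec, Ed; unfold H; ring [Ci_sq].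
Qed.

(** Eliminating [b] gives [(l^2 + be^2) e = - al K3 l a]; multiplying the horizontal relation by
    [l^2 + be^2] then eliminates [e] as well. *)
Lemma system_characteristic (l al be K1 K2 K3 a b c d e : C)
  (Ea : Cmult l a = Cmult al (Cplus (Cplus (Cmult (Cmult Ci K1) c) (Cmult (Cmult Ci K2) d))
                                  (Cmult K3 e)))
  (Eb : Cmult l b = Copp (Cmult be e))
  (Ec : Cmult l c = Cmult al (Cmult (Cmult Ci K1) a))
  (Ed : Cmult l d = Cmult al (Cmult (Cmult Ci K2) a))
  (Ee : Cmult l e = Cplus (Copp (Cmult al (Cmult K3 a))) (Cmult be b)) :
  let H := Cplus (Cmult K1 K1) (Cmult K2 K2) in
  Cmult (Cplus (Cmult (Cmult l l) (Cmult l l)) (Cplus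
    (Cmult (Cmult l l) (Cplus (Cmult (Cmult al al) (Cplus H (Cmult K3 K3))) (Cmult be be)))
    (Cmult (Cmult (Cmult al al) (Cmult be be)) H))) a = RtoC 0.
Proof.
  intros H.
  assert (E1 : Cmult (Cplus (Cmult l l) (Cmult be be)) e = Copp (Cmult (Cmult al K3) (Cmult l a))).
  { transitivity (Cplus (Cmult l (Cmult l e)) (Cmult (Cmult be be) e)); [ring|].
    rewrite Ee.
    transitivity (Cplus (Cplus (Copp (Cmult (Cmult al K3) (Cmult l a))) (Cmult be (Cmult l b)))
       (Cmult (Cmult be be) e)); [ring|].
    rewrite Eb; ring. }
  assert (E2 := system_horizontal _ _ _ _ _ _ _ _ _ Ea Ec Ed); fold H in E2.
  transitivity (Cplus (Cmult (Cplus (Cmult l l) (Cmult be be))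
      (Cmult (Cplus (Cmult l l) (Cmult (Cmult al al) H)) a))
     (Cmult (Cmult (Cmult al al) (Cmult K3 K3)) (Cmult (Cmult l l) a))); [ring|].
  rewrite E2.
  transitivity (Cplus (Cmult (Cmult (Cmult al K3) l) (Cmult (Cplus (Cmult l l) (Cmult be be)) e))
     (Cmult (Cmult (Cmult al al) (Cmult K3 K3)) (Cmult (Cmult l l) a))); [ring|].
  rewrite E1; ring.
Qed.

Lemma disp_factor al be k (X : C) : vertical k <> 0%Z ->
  Cmult (Cplus X (RtoC (gw_sq al be k))) (Cplus X (RtoC (aw_sq al be k))) =
  Cplus (Cmult X X) (Cplus (Cmult X (RtoC (disp_sum al be k))) (RtoC (disp_prod al be k))).
Proof.
  intros Hk. rewrite <- (gw_aw_sum al be k Hk), <- (gw_aw_prod al be k Hk), RtoC_plus, RtoC_mult; ring.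
Qed.

Lemma RtoC_disp_sum al be k1 k2 k3 : RtoC (disp_sum al be (k1, k2, k3)) =
  Cplus (Cmult (Cmult (RtoC al) (RtoC al))
     (Cplus (Cplus (Cmult (RtoC (freq k1)) (RtoC (freq k1))) (Cmult (RtoC (freq k2)) (RtoC (freq k2))))
        (Cmult (RtoC (freq k3)) (RtoC (freq k3))))) (Cmult (RtoC be) (RtoC be)).
Proof.
  unfold disp_sum, ksq, hsq, vertical; rewrite <- !RtoC_mult, <- !RtoC_plus, <- !RtoC_mult, <- !RtoC_plus.
  f_equal; ring.
Qed.

Lemma RtoC_disp_prod al be k1 k2 k3 : RtoC (disp_prod al be (k1, k2, k3)) =
  Cmult (Cmult (Cmult (RtoC al) (RtoC al)) (Cmult (RtoC be) (RtoC be)))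
     (Cplus (Cmult (RtoC (freq k1)) (RtoC (freq k1))) (Cmult (RtoC (freq k2)) (RtoC (freq k2)))).
Proof.
  unfold disp_prod, hsq; rewrite <- !RtoC_mult, <- !RtoC_plus, <- !RtoC_mult.
  f_equal; ring.
Qed.

Lemma Cplus_zero_opp (x y : C) : Cplus x y = RtoC 0 -> x = Copp y.
Proof. intros H; replace x with (Cminus (Cplus x y) y) by ring; rewrite H; ring. Qed.

(** For [l <> 0] the amplitude [a] cannot vanish, since it would force all the others to vanish. It
    can therefore be cancelled from the eliminated equation, leaving the dispersion relation. *)
Lemma mode_spectrum_forward al be k l : 0 < al -> mode_eigenvalue al be k l -> l <> RtoC 0 ->
  (has_gw k /\ Cmult l l = Copp (RtoC (gw_sq al be k))) \/
  (has_aw k /\ Cmult l l = Copp (RtoC (aw_sq al be k))).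
Proof.
  intros Hal (a & b & c & d & e & Hn & Hv & Hs) Hl.
  destruct k as [[k1 k2] k3]; simpl in Hv, Hs.
  destruct Hs as (Ea & Eb & Ec & Ed & Ee); unfold imag in *.
  assert (Al := RtoC_neq al (Rgt_not_eq _ _ Hal)).
  assert (Z : forall t, Cmult l t = RtoC 0 -> t = RtoC 0)
    by (intros t Ht; destruct (Cmult_zero _ _ Ht); tauto).
  assert (SQ : forall X, Cmult l l = Copp (RtoC X) -> X <> 0).
  { intros X E X0; rewrite X0 in E. apply Hl, Z; rewrite E; ring. }
  destruct (Z.eq_dec k3 0) as [E|E].
  - right. destruct (Hv E) as [-> ->].
    assert (Ha : a <> RtoC 0).
    { intros ->; apply Hn; repeat split; auto; apply Z; [rewrite Ec | rewrite Ed]; ring. }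
    assert (S := system_horizontal _ _ _ _ _ _ _ _ _ Ea Ec Ed).
    rewrite !Cmult_0_r in S.
    destruct (Cmult_zero _ _ S) as [S'|]; [|tauto].
    apply Cplus_zero_opp in S'.
    assert (Q : Cmult l l = Copp (RtoC (aw_sq al be (k1, k2, k3)))).
    { rewrite S'; unfold aw_sq, ksq, hsq; simpl; destruct Z.eq_dec; [|tauto].
      rewrite E, freq_0; rewrite <- !RtoC_mult, <- !RtoC_plus, <- !RtoC_mult.
      do 2 f_equal; ring. }
    split; auto. intros K0; apply (SQ _ Q).
    unfold aw_sq; simpl; destruct Z.eq_dec; [|tauto]. rewrite K0; ring.
  - assert (Ha : a <> RtoC 0).
    { intros ->; apply Hn.
      assert (c = RtoC 0) by (apply Z; rewrite Ec; ring).
      assert (d = RtoC 0) by (apply Z; rewrite Ed; ring). subst c d.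
      assert (e = RtoC 0).
      { assert (K := RtoC_neq _ (freq_neq_0 _ E)).
        assert (T : Cmult (RtoC al) (Cmult (RtoC (freq k3)) e) = RtoC 0).
        { transitivity (Cmult l (RtoC 0)); [rewrite Ea|]; ring. }
        destruct (Cmult_zero _ _ T) as [|T']; [tauto|].
        destruct (Cmult_zero _ _ T'); tauto. }
      subst e. repeat split; auto. apply Z; rewrite Eb; ring. }
    assert (S := system_characteristic _ _ _ _ _ _ _ _ _ _ _ Ea Eb Ec Ed Ee).
    destruct (Cmult_zero _ _ S) as [S'|]; [|tauto].
    rewrite <- (RtoC_disp_sum al be k1 k2 k3), <- (RtoC_disp_prod al be k1 k2 k3),
      <- disp_factor in S' by auto.
    assert (KK : ksq (k1, k2, k3) <> 0).
    { unfold ksq; simpl. assert (F := freq_neq_0 _ E).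
      assert (0 < freq k3 * freq k3) by nra. nra. }
    destruct (Cmult_zero _ _ S') as [Q|Q]; apply Cplus_zero_opp in Q; [left|right]; split; auto.
    (* If [K_h = 0] the product of the roots is 0 while the acoustic one is positive; the internal
       one would be 0, against [l <> 0]. *)
    split; auto. intros H0; apply (SQ _ Q).
    assert (P := gw_aw_prod al be (k1, k2, k3) E).
    unfold disp_prod in P; rewrite H0, Rmult_0_r in P.
    assert (B := aw_sq_bounds al be (k1, k2, k3)).
    assert (C := ksq_nonneg (k1, k2, k3)).
    assert (0 < al ^ 2 * ksq (k1, k2, k3)) by (apply Rmult_lt_0_compat; [apply pow_lt|]; lra).
    destruct (Rmult_integral _ _ P); lra.
Qed.

(** The mean flow: a horizontal velocity orthogonal to [K_h], hence divergence free, with all other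
    components zero. Any horizontal velocity will do when [K_h = 0]. *)
Lemma mode_spectrum_zero al be k : mode_eigenvalue al be k 0.
Proof.
  destruct k as [[k1 k2] k3].
  destruct (classic (freq k1 = 0 /\ freq k2 = 0)) as [[E1 E2]|E].
  - exists 0, 0, 1, 0, 0; split; [|split; [auto|]].
    + intros (_ & _ & H & _); apply (RtoC_neq 1); auto; lra.
    + unfold mode_system, imag; rewrite E1, E2; repeat split; ring.
  - exists 0, 0, (RtoC (freq k2)), (Copp (RtoC (freq k1))), 0; split; [|split; [auto|]].
    + intros (_ & _ & H1 & H2 & _); apply E; split.
      * rewrite <- RtoC_opp in H2; apply RtoC_inj in H2; lra.
      * now apply RtoC_inj.
    + unfold mode_system, imag; repeat split; ring.
Qed.

(** The witness solves the last four equations for [b], [c], [d], [e] in terms of [a], scaled by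
    [a = l X] to clear denominators. Its nontriviality is read off from [e], which requires nothing
    about [X]. *)
Lemma mode_spectrum_vertical al be k l : 0 < al -> vertical k <> 0%Z -> l <> RtoC 0 ->
  Cmult (Cplus (Cmult l l) (RtoC (gw_sq al be k))) (Cplus (Cmult l l) (RtoC (aw_sq al be k))) = RtoC 0 ->
  mode_eigenvalue al be k l.
Proof.
  intros Hal Hk Hl H; rewrite disp_factor in H by auto.
  destruct k as [[k1 k2] k3]; rewrite RtoC_disp_sum, RtoC_disp_prod in H; simpl in Hk.
  set (X := Cplus (Cmult l l) (Cmult (RtoC be) (RtoC be))).
  exists (Cmult l X), (Cmult (Cmult (RtoC be) (Cmult (RtoC al) (RtoC (freq k3)))) l),
    (Cmult (Cmult (RtoC al) (imag (freq k1))) X), (Cmult (Cmult (RtoC al) (imag (freq k2))) X),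
    (Copp (Cmult (Cmult (RtoC al) (RtoC (freq k3))) (Cmult l l))).
  split; [|split; [simpl; tauto|]].
  - intros (_ & _ & _ & _ & E).
    apply (f_equal Copp) in E. replace (Copp (RtoC 0)) with (RtoC 0) in E by ring.
    replace (Copp (Copp (Cmult (Cmult (RtoC al) (RtoC (freq k3))) (Cmult l l)))) with
      (Cmult (Cmult (RtoC al) (RtoC (freq k3))) (Cmult l l)) in E by ring.
    assert (Al := RtoC_neq al (Rgt_not_eq _ _ Hal)).
    assert (K := RtoC_neq _ (freq_neq_0 _ Hk)).
    destruct (Cmult_zero _ _ E) as [E'|E']; destruct (Cmult_zero _ _ E'); tauto.
  - unfold X, mode_system, imag; repeat split; try ring.
    (* Only the first equation is left; it is the dispersion relation. *)
    apply Cminus_zero. rewrite <- H. ring [Ci_sq].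
Qed.

Lemma mode_spectrum_flat al be k l : vertical k = 0%Z -> l <> RtoC 0 ->
  Cmult l l = Copp (RtoC (aw_sq al be k)) -> mode_eigenvalue al be k l.
Proof.
  intros Hk Hl H; destruct k as [[k1 k2] k3]; simpl in Hk; subst k3.
  unfold aw_sq, ksq, hsq in H; simpl in H.
  exists l, 0, (Cmult (RtoC al) (imag (freq k1))), (Cmult (RtoC al) (imag (freq k2))), 0.
  split; [tauto|split; [auto|]].
  unfold mode_system, imag; repeat split; try ring.
  - rewrite H. transitivity (Copp (Cmult (Cmult (RtoC al) (RtoC al))
      (Cplus (Cmult (RtoC (freq k1)) (RtoC (freq k1))) (Cmult (RtoC (freq k2)) (RtoC (freq k2)))))).
    + rewrite <- !RtoC_mult, <- !RtoC_plus, <- !RtoC_mult; do 2 f_equal.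
      rewrite freq_0; ring.
    + ring [Ci_sq].
  - rewrite freq_0; ring.
Qed.

Lemma mode_spectrum al be k l : 0 < al ->
  mode_eigenvalue al be k l <->
  l = RtoC 0 \/ (has_gw k /\ Cmult l l = Copp (RtoC (gw_sq al be k))) \/
  (has_aw k /\ Cmult l l = Copp (RtoC (aw_sq al be k))).
Proof.
  intros Hal; split.
  - intros H; destruct (classic (l = RtoC 0)); auto.
    right; now apply mode_spectrum_forward.
  - destruct (classic (l = RtoC 0)) as [->|Hl]; [intros; apply mode_spectrum_zero|].
    intros [|[[[Hk _] H]|[Hk H]]]; [tauto| |].
    + apply mode_spectrum_vertical; auto; rewrite H; ring.
    + destruct (Z.eq_dec (vertical k) 0).
      * now apply mode_spectrum_flat.
      * apply mode_spectrum_vertical; auto; rewrite H; ring.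
Qed.

Lemma imag_inj x y : imag x = imag y -> x = y.
Proof.
  unfold imag, Cmult, Ci, RtoC; simpl; intros H; injection H; lra.
Qed.

Lemma imag_0 : imag 0 = RtoC 0.
Proof. unfold imag; ring. Qed.

Lemma imag_sq x : Cmult (imag x) (imag x) = Copp (RtoC (x ^ 2)).
Proof.
  replace (x ^ 2) with (x * x) by ring. unfold imag; rewrite RtoC_mult; ring [Ci_sq].
Qed.

(** [l^2 + X] factors as [(l - i sqrt X) (l + i sqrt X)]. This is where eigenvalues turn out to be
    imaginary. *)
Lemma sq_neg_imag l X : 0 <= X -> Cmult l l = Copp (RtoC X) -> exists w, l = imag w.
Proof.
  intros HX H.
  assert (E : Cmult (Cminus l (imag (sqrt X))) (Cplus l (imag (sqrt X))) = RtoC 0).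
  { transitivity (Cminus (Cmult l l) (Cmult (imag (sqrt X)) (imag (sqrt X)))); [ring|].
    rewrite H, imag_sq, pow2_sqrt by auto; ring. }
  destruct (Cmult_zero _ _ E) as [E'|E'].
  - exists (sqrt X); now apply Cminus_zero.
  - exists (- sqrt X). apply Cplus_zero_opp in E'; rewrite E'.
    unfold imag; rewrite RtoC_opp; ring.
Qed.

Lemma imag_sq_iff w X : 0 <= X -> (Cmult (imag w) (imag w) = Copp (RtoC X) <-> Rabs w = Rabs (sqrt X)).
Proof.
  intros HX; rewrite imag_sq, (Rabs_pos_eq (sqrt X)) by apply sqrt_pos; split.
  - intros H. apply (f_equal Copp) in H; rewrite <- !RtoC_opp, !Ropp_involutive in H.
    apply RtoC_inj in H. rewrite <- H, <- Rsqr_pow2, sqrt_Rsqr_abs; auto.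
  - intros H. do 2 f_equal. rewrite <- (pow2_abs w), H, pow2_sqrt; auto.
Qed.

Lemma mode_eigenvalue_imag al be k l : 0 < al -> mode_eigenvalue al be k l -> exists w, l = imag w.
Proof.
  intros Hal H; apply mode_spectrum in H; auto.
  destruct H as [->|[[_ H]|[_ H]]].
  - exists 0; now rewrite imag_0.
  - apply (sq_neg_imag l (gw_sq al be k)); auto; apply gw_sq_bounds.
  - apply (sq_neg_imag l (aw_sq al be k)); auto; apply aw_sq_nonneg.
Qed.

Lemma mode_spectrum_imag al be k w : 0 < al ->
  mode_eigenvalue al be k (imag w) <->
  Rabs w = 0 \/ (has_gw k /\ Rabs w = Rabs (sqrt (gw_sq al be k))) \/
  (has_aw k /\ Rabs w = Rabs (sqrt (aw_sq al be k))).
Proof.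
  intros Hal; rewrite mode_spectrum by auto.
  rewrite !imag_sq_iff by (apply gw_sq_bounds || apply aw_sq_nonneg).
  assert (E : imag w = RtoC 0 <-> Rabs w = 0).
  { rewrite <- imag_0; split.
    - intros H; apply imag_inj in H; rewrite H; apply Rabs_R0.
    - intros H; f_equal; apply NNPP; intros N; now apply (Rabs_no_R0 w). }
  rewrite E; tauto.
Qed.

(** * Comparison with the acoustic spectrum *)

Lemma La_eq_lin_comb U : La U = lin_comb 1 0 U.
Proof.
  unfold lin_comb, fadd, fscal, La, Lg; simpl; f_equal; apply scalar_eq; intros;
    unfold sadd, sscal, szero; ring.
Qed.

(** Without gravity the two bounds on [aw_sq] coincide and give [aw_sq 1 0 k = ksq k]. *)
Lemma eigenvalue_La_of_mode k w : w ^ 2 = ksq k -> eigenvalue La (imag w).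
Proof.
  intros H. replace La with (lin_comb 1 0).
  2:{ apply functional_extensionality; intros; now rewrite La_eq_lin_comb. }
  apply (mode_eigenvalue_eigenvalue 1 0 k).
  assert (B := aw_sq_bounds 1 0 k).
  assert (E : aw_sq 1 0 k = w ^ 2) by lra.
  apply mode_spectrum; [lra|].
  destruct (Req_dec w 0) as [->|N]; [left; apply imag_0|].
  right; right; split.
  - unfold has_aw; rewrite <- H; nra.
  - rewrite imag_sq, E; auto.
Qed.

(** Acoustic waves are compared with the unperturbed frequency at their own [k]; mean flow and
    internal waves with the frequency 0, carried by [k' = 0]. *)
Lemma pert_bounds be k w : mode_eigenvalue 1 be k (imag w) ->
  exists k', ksq k' <= w ^ 2 <= ksq k' + be ^ 2.
Proof.
  intros H; apply mode_spectrum_imag in H; [|lra].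
  assert (B0 := pow2_ge_0 be).
  assert (K0 : ksq (0, 0, 0)%Z = 0) by (unfold ksq, hsq, freq; simpl; ring).
  rewrite <- (pow2_abs w).
  destruct H as [H|[[_ H]|[_ H]]]; rewrite H.
  - exists (0, 0, 0)%Z; lra.
  - assert (B := gw_sq_bounds 1 be k). exists (0, 0, 0)%Z; rewrite pow2_abs, pow2_sqrt; lra.
  - assert (B := aw_sq_bounds 1 be k). exists k; rewrite pow2_abs, pow2_sqrt; [lra|].
    apply aw_sq_nonneg.
Qed.

(** * Orders of magnitude of the frequencies *)

Lemma le_sqrt_of_sq x X : 0 <= x -> x ^ 2 <= X -> x <= sqrt X.
Proof. intros H1 H2; rewrite <- (sqrt_pow2 x) by auto; now apply sqrt_le_1_alt. Qed.

Lemma sqrt_le_of_sq x X : 0 <= x -> X <= x ^ 2 -> sqrt X <= x.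
Proof. intros H1 H2; rewrite <- (sqrt_pow2 x) by auto; now apply sqrt_le_1_alt. Qed.

Lemma at_right_0_lt_1 (P : R -> Prop) : (forall eps, 0 < eps < 1 -> P eps) -> at_right 0 P.
Proof.
  intros H; exists (mkposreal 1 Rlt_0_1); intros y Hy Hy0; apply H; split; auto.
  change (Rabs (y - 0) < 1) in Hy; apply Rabs_def2 in Hy; lra.
Qed.

Lemma Rpower_opp_1 eps : 0 < eps -> Rpower eps (- 1) = / eps.
Proof.
  intros H; change (- 1) with (Ropp 1); now rewrite Rpower_Ropp, Rpower_1.
Qed.

Lemma Rpower_le_inv eps nu : 0 < eps < 1 -> nu <= 1 -> Rpower eps (- nu) <= Rpower eps (- 1).
Proof.
  intros He Hn; unfold Rpower.
  assert (L : ln eps < 0) by (rewrite <- ln_1; apply ln_increasing; lra).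
  destruct (Req_dec nu 1) as [->|]; [right; auto|].
  left; apply exp_increasing; nra.
Qed.

(** The upper bound is [X- <= be^2]. For the lower one, [X- X+ = al^2 be^2 |K_h|^2] while
    [X+ <= al^2 (|K|^2 + 1)] because [be <= al]; hence the constant [hsq k / (ksq k + 1)]. *)
Lemma gw_same_order nu k : 0 < nu < 1 -> has_gw k ->
  same_order (fun eps => sqrt (gw_sq (/ eps) (/ Rpower eps nu) k)) (fun eps => Rpower eps (- nu)).
Proof.
  intros Hnu [Hk Hh].
  assert (H0 := hsq_nonneg k). assert (K0 := ksq_nonneg k).
  assert (C : 0 < hsq k / (ksq k + 1)) by (apply Rdiv_lt_0_compat; lra).
  exists (sqrt (hsq k / (ksq k + 1))), 1; split; [now apply sqrt_lt_R0|split; [lra|]].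
  apply at_right_0_lt_1; intros eps He.
  assert (Le := Rpower_le_inv eps nu He ltac:(lra)).
  rewrite <- Rpower_Ropp.
  assert (I := Rpower_opp_1 eps (proj1 He)).
  rewrite I in Le.
  assert (Bp : 0 < Rpower eps (- nu)) by apply exp_pos.
  set (be := Rpower eps (- nu)) in *; set (al := / eps) in *.
  rewrite Rabs_pos_eq by apply sqrt_pos. split.
  - apply le_sqrt_of_sq; [apply Rmult_le_pos; [apply sqrt_pos | lra]|].
    rewrite Rpow_mult_distr, pow2_sqrt by lra.
    assert (P := gw_aw_prod al be k Hk). assert (B := aw_sq_bounds al be k).
    assert (G := gw_sq_bounds al be k). unfold disp_prod in P.
    assert (A2 : 0 < al ^ 2) by (apply pow_lt; lra).
    assert (Q : gw_sq al be k * aw_sq al be k <= gw_sq al be k * (al ^ 2 * (ksq k + 1))).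
    { apply Rmult_le_compat_l; [lra|]. nra. }
    rewrite P in Q.
    apply (Rmult_le_reg_l (al ^ 2 * (ksq k + 1))); [nra|].
    replace (al ^ 2 * (ksq k + 1) * (hsq k / (ksq k + 1) * be ^ 2)) with (al ^ 2 * be ^ 2 * hsq k)
      by (field; lra). lra.
  - rewrite Rmult_1_l; apply sqrt_le_of_sq; [lra|]. apply gw_sq_bounds.
Qed.

Lemma aw_same_order nu k : 0 < nu < 1 -> has_aw k ->
  same_order (fun eps => sqrt (aw_sq (/ eps) (/ Rpower eps nu) k)) (fun eps => Rpower eps (- 1)).
Proof.
  intros Hnu Hk; assert (K0 := ksq_nonneg k); unfold has_aw in Hk.
  exists (sqrt (ksq k)), (sqrt (ksq k + 1)).
  split; [apply sqrt_lt_R0; lra|split; [apply sqrt_lt_R0; lra|]].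
  apply at_right_0_lt_1; intros eps He.
  assert (Le := Rpower_le_inv eps nu He ltac:(lra)).
  rewrite <- Rpower_Ropp.
  assert (I := Rpower_opp_1 eps (proj1 He)).
  rewrite I in *.
  assert (Bp : 0 < Rpower eps (- nu)) by apply exp_pos.
  set (be := Rpower eps (- nu)) in *; set (al := / eps) in *.
  assert (B := aw_sq_bounds al be k).
  rewrite Rabs_pos_eq by apply sqrt_pos. split.
  - apply le_sqrt_of_sq; [apply Rmult_le_pos; [apply sqrt_pos | lra]|].
    rewrite Rpow_mult_distr, pow2_sqrt; lra.
  - apply sqrt_le_of_sq; [apply Rmult_le_pos; [apply sqrt_pos | lra]|].
    rewrite Rpow_mult_distr, pow2_sqrt by lra. nra.
Qed.

Lemma three_families_hold nu : 0 < nu < 1 -> three_families nu.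
Proof.
  intros Hnu.
  assert (F1 := freq_neq_0 1 ltac:(lia)).
  (* Nonzero horizontal and vertical parts: this wave number carries internal and acoustic waves, so
     neither family is empty. *)
  assert (G : has_gw (1, 0, 1)%Z).
  { split; [simpl; lia|]. unfold hsq; rewrite freq_0.
    assert (T := pow2_gt_0 (freq 1) F1); lra. }
  exists (fun _ => True), has_gw, has_aw, (fun _ _ => 0),
    (fun k eps => sqrt (gw_sq (/ eps) (/ Rpower eps nu) k)),
    (fun k eps => sqrt (aw_sq (/ eps) (/ Rpower eps nu) k)).
  split; [now exists (0, 0, 0)%Z|]. split; [now exists (1, 0, 1)%Z|].
  split; [exists (1, 0, 1)%Z|].
  { destruct G as [_ G]; unfold has_aw; assert (A := hsq_le_ksq (1, 0, 1)%Z).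
    assert (B := hsq_nonneg (1, 0, 1)%Z); lra. }
  split; [intros; apply Rabs_R0|].
  split; [intros; now apply gw_same_order|]. split; [intros; now apply aw_same_order|].
  intros eps He; assert (Hal : 0 < / eps) by (apply Rinv_0_lt_compat; lra); split.
  - intros l Hl; destruct (eigenvalue_mode _ _ _ Hl) as [k Hk].
    destruct (mode_eigenvalue_imag _ _ _ _ Hal Hk) as [w Hw].
    exists k, w; split; auto. now apply eigenvalue_at_iff.
  - intros k w; unfold L_full; rewrite eigenvalue_at_iff, mode_spectrum_imag by auto.
    rewrite Rabs_R0; tauto.
Qed.

(** * Distance to the acoustic eigenvalues *)

Lemma Cmod_imag_minus x y : Cmod (Cminus (imag x) (imag y)) = Rabs (x - y).
Proof.
  replace (Cminus (imag x) (imag y)) with (Cmult Ci (RtoC (x - y)))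
    by (unfold imag; rewrite RtoC_minus; ring).
  rewrite Cmod_mult, Cmod_R.
  replace (Cmod Ci) with 1; [ring|]. unfold Cmod, Ci; simpl.
  replace (0 * (0 * 1) + 1 * (1 * 1)) with 1 by ring; now rewrite sqrt_1.
Qed.

Theorem proposition5 (nu : R) (hnu : 0 < 2 * nu < 1)
    (om : pm -> nat -> R) (hom : acoustic_frequencies om) :
  (forall eps : R, 0 < eps < 1 ->
     (forall lambda : C, eigenvalue (L_pert nu eps) lambda ->
        exists mu : C, eigenvalue La mu /\
          Cmod (Cminus lambda mu) <= Rpower eps (1 - nu)) /\
     (forall omega : R, eigenvalue (L_pert nu eps) (imag omega) ->
        exists m : nat, forall s : pm,
          Rabs (om s m) ^ 2 <= Rabs omega ^ 2 <=
            Rabs (om s m) ^ 2 + Rpower eps (2 - 2 * nu))) /\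
  three_families nu.
Proof.
  split; [|apply three_families_hold; lra].
  intros eps He.
  assert (Bp : 0 < Rpower eps (1 - nu)) by apply exp_pos.
  assert (B2 : Rpower eps (2 - 2 * nu) = Rpower eps (1 - nu) ^ 2).
  { replace (2 - 2 * nu) with ((1 - nu) + (1 - nu)) by ring.
    rewrite Rpower_plus; ring. }
  rewrite B2; unfold L_pert; set (be := Rpower eps (1 - nu)) in *; split.
  - intros l Hl; destruct (eigenvalue_mode _ _ _ Hl) as [k Hk].
    destruct (mode_eigenvalue_imag _ _ _ _ Rlt_0_1 Hk) as [w ->].
    destruct (pert_bounds _ _ _ Hk) as [k' Hb].
    assert (R2 := pow2_sqrt _ (ksq_nonneg k')). assert (R0 := sqrt_pos (ksq k')).
    set (r := sqrt (ksq k')) in *.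
    (* The acoustic eigenvalue is chosen with the sign of [w]; then
       [r^2 <= w^2 <= r^2 + be^2 <= (r + be)^2] bounds the distance by [be]. *)
    destruct (Rle_dec 0 w).
    + exists (imag r); split; [now apply (eigenvalue_La_of_mode k')|].
      rewrite Cmod_imag_minus; apply Rabs_le; nra.
    + exists (imag (- r)); split; [apply (eigenvalue_La_of_mode k'); nra|].
      rewrite Cmod_imag_minus; apply Rabs_le; nra.
  - intros w Hl; destruct (eigenvalue_mode _ _ _ Hl) as [k Hk].
    destruct (pert_bounds _ _ _ Hk) as [k' Hb].
    destruct hom as (_ & _ & Hpm & Hev).
    assert (R2 := pow2_sqrt _ (ksq_nonneg k')).
    (* The enumeration of the acoustic spectrum supplies the index [m] of [sqrt (ksq k')]; the
       pairing of opposite frequencies extends the bound to both signs. *)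
    destruct (proj1 (Hev _) (eigenvalue_La_of_mode k' _ R2)) as (s & m & E).
    apply imag_inj in E.
    exists m; intros s'; rewrite !pow2_abs.
    assert (Es : om s' m ^ 2 = ksq k').
    { rewrite <- R2, E; assert (P := Hpm m).
      destruct s, s'; auto; rewrite P; ring. }
    lra.
Qed.
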